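(* Let $d\ge 2$ and $h=0$. There exist $\beta_c,\lambda_c>0$ such that for all $\beta\ge\beta_c$ and all $\lambda\ge\lambda_c$ the soft-core Widom-Rowlinson model on $\mathbb Z^d$ has a phase transition, i.e. $|\mathcal G(\gamma^{sc}_{\beta,\lambda,0})|>1$.
   Context: Let $E=\{-1,0,1\}$ with the discrete topology and $\Omega=E^{\mathbb Z^d}$ with the product $\sigma$-algebra $\mathcal F$. For $\Lambda\subset\mathbb Z^d$ write $\Omega_\Lambda=E^\Lambda$, $\Lambda^c=\mathbb Z^d\setminus\Lambda$, and $\mathcal F_\Lambda$ for the $\sigma$-algebra generated by the coordinates in $\Lambda$. Write $i\sim j$ if $\|i-j\|_1=1$, and for finite $\Lambda$ let $\mathcal E^b_\Lambda=\{\{i,j\}\subset\mathbb Z^d: i\sim j,\ \{i,j\}\cap\Lambda\ne\emptyset\}$. A specification $\gamma=(\gamma_\Lambda)$, indexed by finite $\Lambda\subset\mathbb Z^d$, is a family of probability kernels from $\mathcal F_{\Lambda^c}$ to $\mathcal F$ with $\gamma_\Lambda(B|\cdot)=\mathbf 1_B$ for $B\in\mathcal F_{\Lambda^c}$ and $\gamma_\Lambda(\gamma_\Delta(A|\cdot)|\omega)=\gamma_\Lambda(A|\omega)$ for $\Delta\subset\Lambda$, $A\in\mathcal F$. A probability measure $\mu$ on $(\Omega,\mathcal F)$ is admitted by $\gamma$ if $\mu(A|\mathcal F_{\Lambda^c})=\gamma_\Lambda(A|\cdot)$ $\mu$-a.s. for all finite $\Lambda$ and $A\in\mathcal F$; $\mathcal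 G(\gamma)$ is the set of probability measures admitted by the (quasilocal) specification $\gamma$. For $\beta,\lambda>0$, $h\in\mathbb R$, the soft-core Widom-Rowlinson specification is, for finite $\Lambda$, $\omega\in\Omega_\Lambda$, $\eta\in\Omega_{\Lambda^c}$, $$\gamma^{sc}_{\Lambda,\beta,\lambda,h}(\omega|\eta)=\frac1{Z_\eta}\exp\Big(-\beta\sum_{\{i,j\}\in\mathcal E^b_\Lambda}\mathbf 1(\xi_i\xi_j=-1)+\sum_{i\in\Lambda}\big(\log(\lambda)\,\xi_i^2+h\,\xi_i\big)\Big),\qquad \xi=\omega_\Lambda\eta_{\Lambda^c},$$ where $Z_\eta$ normalizes to a probability measure on $\Omega_\Lambda$ (extended to $\Omega$ by fixing the configuration $\eta$ off $\Lambda$). *)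

(* Defs.v *)
From HB Require Import structures.
From mathcomp Require Import all_boot all_order all_algebra finmap.
From mathcomp Require Import zify ring.
From mathcomp Require Import all_classical all_reals all_analysis measurable_realfun.

Set Implicit Arguments.
Unset Strict Implicit.
Unset Printing Implicit Defensive.
Import Order.TTheory GRing.Theory Num.Theory.
Import numFieldNormedType.Exports.
Local Open Scope classical_set_scope.
Local Open Scope ring_scope.

Notation site d := 'rV[int]_d.

Definition norm1 d (i : site d) : int := \sum_(k < d) `|i 0 k|.

Definition adj d (i j : site d) : bool := norm1 (i - j) == 1.

Definition spin := seq_sub [:: -1; 0; 1 : int].
HB.instance Definition _ := Finite.on spin.
Fact spin0_subproof : (0 : int) \in [:: -1; 0; 1 : int]. Proof. by []. Qed.
HB.instance Definition _ := isPointed.Build spin (SeqSub spin0_subproof).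

Definition spin_val (s : spin) : int := ssval s.

Definition config (d : nat) := site d -> spin.
HB.instance Definition _ d := Pointed.on (config d).

(* Single spins carry the discrete sigma-algebra, so every preimage of a set of
   spins under a coordinate in [I] is a generator. *)
Definition coord_sets d (I : set (site d)) : set (set (config d)) :=
  \bigcup_(i in I) preimage_set_system setT (fun w : config d => w i) setT.

(* The types [coordT I] all have [config d] as carrier and differ only by their
   sigma-algebra F_I; [confT d] is the configuration space with the full product
   sigma-algebra. *)
Notation coordT I := (g_sigma_algebraType (coord_sets I)).
Notation confT d := (coordT [set: site d]).

(* An infinite set of fsets a priori; see [finite_bedges] below, which makes the
   finitely supported sum over it in [wr_exponent] the usual one. *)
Definition bedges d (L : {fset site d}) : set {fset site d} :=
  [set e | exists i j : site d, [/\ e = [fset i; j]%fset, adj i j &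
     (e `&` L)%fset != fset0]].

Definition paste d (L : {fset site d}) (w : {ffun L -> spin}) (eta : config d)
  : config d := fun i => if insub i is Some k then w k else eta i.

(* No quasilocality is imposed: it plays no role in the notion of an admitted
   measure, and a finite-range specification such as [wr_spec] below has it. *)
Record specification (R : realType) (d : nat) := Specification {
  spec_ker :> forall L : {fset site d}, R.-pker (coordT (~` [set` L])) ~> (confT d) ;
  spec_proper : forall (L : {fset site d}) (B : set (coordT (~` [set` L]))),
    measurable B -> forall w, spec_ker L w B = (\1_B w)%:E ;
  spec_consistent : forall (D L : {fset site d}), (D `<=` L)%fset ->
    forall A : set (confT d), measurable A -> forall w,
      (\int[spec_ker L w]_(x in setT) spec_ker D x A)%E = spec_ker L w A }.

(* [f] is a version of the conditional probability mu(A | F_I). *)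
Definition cond_prob_version (R : realType) d (mu : probability (confT d) R)
    (I : set (site d)) (A : set (confT d)) (f : config d -> \bar R) : Prop :=
  [/\ measurable_fun [set: coordT I] (f : coordT I -> \bar R),
      mu.-integrable [set: confT d] (f : confT d -> \bar R) &
      forall B : set (config d), measurable (B : set (coordT I)) ->
        (\int[mu]_(w in (B : set (confT d))) f w)%E = mu (A `&` B)].

Definition admitted (R : realType) d (g : specification R d)
    (mu : probability (confT d) R) : Prop :=
  forall (L : {fset site d}) (A : set (confT d)), measurable A ->
    exists2 f : config d -> \bar R,
      cond_prob_version mu (~` [set` L]) A f & {ae mu, forall w, f w = g L w A}.

Definition gibbs (R : realType) d (g : specification R d)
  : set (probability (confT d) R) := [set mu | admitted g mu].

(* |gibbs g| > 1. Distinctness is tested on measurable sets because a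
   [probability] is a function on all sets whose values outside the
   sigma-algebra are unconstrained, so [mu <> nu] would be too weak. *)
Definition phase_transition (R : realType) d (g : specification R d) : Prop :=
  exists mu nu : probability (confT d) R,
    [/\ gibbs g mu, gibbs g nu &
        exists2 A : set (confT d), measurable A & mu A <> nu A].

Lemma finite_nbhd d : finite_set [set u : site d | norm1 u == 1].
Proof.
apply: (@sub_finite_set _ _ (range
  (fun f : {ffun 'I_d -> 'I_3} => \row_k ((f k : nat)%:Z - 1) : site d))).
  move=> u /= /eqP u1.
  have uk k : `|u 0 k| <= 1.
    rewrite -u1 /norm1 (bigD1 k)//= lerDl; apply: sumr_ge0 => j _.
    exact: normr_ge0.
  have lt3 k : (absz (u 0 k + 1)%R < 3)%N by have := uk k; lia.
  exists [ffun k => Ordinal (lt3 k)] => //.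
  by apply/rowP => k; rewrite mxE ffunE /=; have := uk k; lia.
exact/finite_image/finite_finset.
Qed.

Lemma finite_bedges d (L : {fset site d}) : finite_set (bedges L).
Proof.
apply: (@sub_finite_set _ _ ((fun p : site d * site d => [fset p.1; p.1 - p.2]%fset)
   @` ([set` L] `*` [set u : site d | norm1 u == 1]))); last first.
  apply: finite_image; apply: finite_setX; last exact: finite_nbhd.
  exact: finite_fset.
have sym i j : adj i j -> adj j i.
  by move=> /eqP ij; apply/eqP; rewrite -ij; apply: eq_bigr => k _;
     rewrite !mxE distrC.
move=> e [i [j [-> ij /fset0Pn[k]]]]; rewrite !inE => /andP[/orP[]/eqP -> kL].
  by exists (i, i - j) => //=; rewrite opprB addrC subrK.
by exists (j, j - i) => /=; [split => //; exact: sym | rewrite opprB addrC subrK fsetUC].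
Qed.

Lemma paste_in d (L : {fset site d}) (w : {ffun L -> spin}) eta i (iL : i \in L) :
  paste w eta i = w [` iL]%fset.
Proof. by rewrite /paste insubT. Qed.

Lemma paste_notin d (L : {fset site d}) (w : {ffun L -> spin}) eta i :
  i \notin L -> paste w eta i = eta i.
Proof. by move=> iL; rewrite /paste insubN. Qed.

Lemma coord_measurable d (I : set (site d)) (i : site d) (a : set spin) :
  I i -> measurable ([set w | a (w i)] : set (coordT I)).
Proof.
by move=> Ii; apply: sub_sigma_algebra; exists i => //; exists a => //; rewrite setTI.
Qed.

Lemma paste_measurable d (L : {fset site d}) (w : {ffun L -> spin}) :
  measurable_fun [set: coordT (~` [set` L])]
    (paste w : coordT (~` [set` L]) -> confT d).
Proof.
apply: (@measurability _ _ (coordT (~` [set` L])) (confT d) setT _ (coord_sets [set: site d])) => //.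
move=> _ [_ [i _ [a _ <-]] <-]; rewrite !setTI.
have [iL|iL] := boolP (i \in L).
  have -> : paste w @^-1` ((fun w0 : config d => w0 i) @^-1` a) =
      (if w [` iL]%fset \in a then setT else set0 : set (coordT (~` [set` L]))).
    rewrite /paste; apply/seteqP; split => eta /=; rewrite insubT.
      by move=> /mem_set ->.
    by case: ifPn => // /set_mem.
  by case: ifP.
have -> : paste w @^-1` ((fun w0 : config d => w0 i) @^-1` a) =
    [set eta : coordT (~` [set` L]) | a (eta i)].
  by rewrite /paste; apply/seteqP; split => eta /=; rewrite insubN.
by apply: coord_measurable => /=; exact/negP.
Qed.

Section SoftCoreWR.
Context (R : realType) (d : nat) (beta lambda h : R).

(* For an edge [e = {i, j}] with [i <> j], the product over [e] is the product of
   the spins at [i] and [j]. *)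
Definition wr_exponent (L : {fset site d}) (xi : config d) : R :=
  - beta * (\sum_(e \in bedges L) ((\prod_(i <- e) spin_val (xi i) == -1)%:R : R))
  + \sum_(i <- L) (ln lambda * (spin_val (xi i))%:~R ^+ 2
                   + h * (spin_val (xi i))%:~R).

Definition wr_weight (L : {fset site d}) (w : {ffun L -> spin}) (eta : config d) : R :=
  expR (wr_exponent L (paste w eta)).

Definition wr_Z (L : {fset site d}) (eta : config d) : R :=
  \sum_(w : {ffun L -> spin}) wr_weight w eta.

Definition wr_prob (L : {fset site d}) (w : {ffun L -> spin}) (eta : config d) : R :=
  wr_weight w eta / wr_Z L eta.

Definition wr_measure (L : {fset site d}) (eta : coordT (~` [set` L]))
    (A : set (confT d)) : \bar R :=
  (\sum_(w : {ffun L -> spin}) (wr_prob w eta)%:E * \d_(paste w eta : confT d) A)%E.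


Lemma measurable_wr_exponent (L : {fset site d}) :
  measurable_fun [set: confT d] (wr_exponent L : confT d -> R).
Proof.
have mspin (g : spin -> R) (i : site d) :
    measurable_fun [set: confT d] ((fun xi => g (xi i)) : confT d -> R).
  move=> _ Y mY; rewrite setTI.
  exact: (@coord_measurable d setT i (g @^-1` Y)).
apply: measurable_funD.
  apply: measurable_funM => //.
  under eq_fun do rewrite (fsbig_finite _ _ (finite_bedges L)).
  apply: measurable_sum => e.
  pose P (xi : confT d) : R := \prod_(i <- e) (spin_val (xi i))%:~R.
  have mP : measurable_fun [set: confT d] P.
    apply: (@measurable_prod _ (confT d) R _ _ e
      (fun i xi => (spin_val (xi i))%:~R)) => i _.
    exact: (mspin (fun s => (spin_val s)%:~R)).
  have mS : measurable (P @^-1` [set -1]).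
    by rewrite -[X in measurable X]setTI; apply: mP => //; exact: measurable_set1.
  rewrite (_ : (fun _ => _) = \1_(P @^-1` [set -1])); first exact: measurable_indic.
  apply/funext => xi; rewrite indicE; congr (nat_of_bool _)%:R.
  have PE : P xi = (\prod_(i <- e) spin_val (xi i))%:~R by rewrite rmorph_prod.
  apply/eqP/idP => [e1|/set_mem /= /eqP].
    by apply/mem_set; rewrite /= PE e1 rmorphN1.
  by rewrite PE -[-1](rmorphN1 (intmul 1)) eqr_int => /eqP.
apply: measurable_sum => i; exact: (mspin (fun s => ln lambda * (spin_val s)%:~R ^+ 2 + h * (spin_val s)%:~R)).
Qed.

Lemma wr_weight_gt0 (L : {fset site d}) (w : {ffun L -> spin}) eta : 0 < wr_weight w eta.
Proof. exact: expR_gt0. Qed.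

Lemma wr_Z_gt0 (L : {fset site d}) eta : 0 < wr_Z L eta.
Proof.
rewrite /wr_Z (bigD1 ([ffun=> point : spin] : {ffun L -> spin}))//= ltr_pwDl ?wr_weight_gt0//.
by apply: sumr_ge0 => w _; exact/ltW/wr_weight_gt0.
Qed.

Lemma wr_prob_ge0 (L : {fset site d}) (w : {ffun L -> spin}) eta : 0 <= wr_prob w eta.
Proof. by rewrite divr_ge0// ltW// ?wr_weight_gt0// wr_Z_gt0. Qed.

Lemma wr_prob_sum (L : {fset site d}) eta : \sum_(w : {ffun L -> spin}) wr_prob w eta = 1.
Proof. by rewrite -mulr_suml divff// gt_eqF// wr_Z_gt0. Qed.

Lemma measurable_wr_prob (L : {fset site d}) (w : {ffun L -> spin}) :
  measurable_fun [set: coordT (~` [set` L])] (wr_prob w).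
Proof.
have mW (v : {ffun L -> spin}) :
    measurable_fun [set: coordT (~` [set` L])] (wr_weight v : coordT _ -> R).
  apply: (@measurableT_comp _ _ _ _ _ _ expR) => //.
  apply: (measurableT_comp (measurable_wr_exponent L)).
  exact: paste_measurable.
rewrite (_ : wr_prob w = fun eta => wr_weight w eta * expR (- ln (wr_Z L eta))); last first.
  by apply/funext => eta; rewrite expRN lnK// posrE wr_Z_gt0.
apply: measurable_funM; first exact: mW.
apply: (@measurableT_comp _ _ _ _ _ _ expR) => //.
apply: measurable_funN; apply: (@measurableT_comp _ _ _ _ _ _ (@ln R)).
  exact: measurable_ln.
by apply: measurable_sum.
Qed.

Section measure.
Variables (L : {fset site d}) (eta : coordT (~` [set` L])).

Let wr_measure0 : wr_measure eta set0 = 0%E.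
Proof. by apply: big1 => w _; rewrite measure0 mule0. Qed.

Let wr_measure_ge0 A : (0 <= wr_measure eta A)%E.
Proof. by apply: sume_ge0 => w _; rewrite mule_ge0// lee_fin wr_prob_ge0. Qed.

Let wr_measure_sigma_additive : semi_sigma_additive (wr_measure eta).
Proof.
move=> F mF tF mUF.
rewrite [X in X @ _ --> _](_ : _ = fun n => (\sum_(w : {ffun L -> spin})
   (wr_prob w eta)%:E * \sum_(0 <= i < n) \d_(paste w eta : confT d) (F i))%E); last first.
  apply/funext => n; rewrite exchange_big /=; apply: eq_bigr => w _.
  by rewrite ge0_sume_distrr.
apply: cvg_nnesum => w _.
  by near=> n; rewrite mule_ge0// ?lee_fin ?wr_prob_ge0//; exact: sume_ge0.
by apply: cvgeZl => //; exact: measure_semi_sigma_additive.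
Unshelve. all: by end_near. Qed.

HB.instance Definition _ := isMeasure.Build _ _ _ (wr_measure eta)
  wr_measure0 wr_measure_ge0 wr_measure_sigma_additive.

Lemma integral_wr_measure (f : confT d -> \bar R) :
  measurable_fun setT f -> (forall x, 0 <= f x)%E ->
  (\int[wr_measure eta]_(x in setT) f x =
   \sum_(w : {ffun L -> spin}) (wr_prob w eta)%:E * f (paste w eta))%E.
Proof.
move=> mf f0.
pose T := {ffun L -> spin}.
pose w_ n : T := nth [ffun=> point : spin] (index_enum T) n.
pose m_ n := mscale (NngNum (wr_prob_ge0 (w_ n) eta)) (\d_(paste (w_ n) eta : confT d)).
rewrite (@eq_measure_integral _ _ _ _ (msum m_ (size (index_enum T)))); last first.
  move=> A mA _; rewrite /= /wr_measure (big_nth ([ffun=> point : spin] : T)) big_mkord.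
  by rewrite /msum; apply: eq_bigr => n _.
rewrite ge0_integral_measure_sum// [RHS](big_nth ([ffun=> point : spin] : T)) big_mkord.
apply: eq_bigr => n _; rewrite ge0_integral_mscale//= integral_dirac//.
by rewrite diracT mul1e.
Qed.

End measure.

Section kernel.
Variable L : {fset site d}.

Let wr_kernel_measurable (U : set (confT d)) : measurable U ->
  measurable_fun [set: coordT (~` [set` L])] ((@wr_measure L) ^~ U).
Proof.
move=> mU; apply: emeasurable_sum => w; apply: emeasurable_funM.
  by apply/measurable_EFinP; exact: measurable_wr_prob.
have mp := @paste_measurable d L w.
exact: (measurableT_comp (measurable_fun_dirac mU) mp).
Qed.

Definition wr_kernel_fun (eta : coordT (~` [set` L])) : {measure set (confT d) -> \bar R} :=
  wr_measure eta.

HB.instance Definition _ := isKernel.Build _ _ _ _ R wr_kernel_fun wr_kernel_measurable.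

Let wr_kernel_prob eta : wr_kernel_fun eta setT = 1%E.
Proof.
rewrite /= /wr_measure; under eq_bigr do rewrite diracT mule1.
by rewrite sumEFin wr_prob_sum.
Qed.

HB.instance Definition _ := Kernel_isProbability.Build _ _ _ _ R wr_kernel_fun wr_kernel_prob.

Definition wr_kernel : R.-pker (coordT (~` [set` L])) ~> (confT d) := wr_kernel_fun.

End kernel.

Lemma wr_proper (L : {fset site d}) (B : set (coordT (~` [set` L]))) :
  measurable B -> forall eta, wr_kernel L eta B = (\1_B eta)%:E.
Proof.
move=> mB eta.
have inv : forall (w : {ffun L -> spin}) xi, B (paste w xi) <-> B xi.
  pose G : set (set (config d)) :=
    [set C | forall (w : {ffun L -> spin}) xi, C (paste w xi) <-> C xi].
  suff /(_ B mB) : (measurable : set (set (coordT (~` [set` L])))) `<=` G by [].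
  apply: smallest_sub.
    split=> [w xi|C GC w xi|F GF w xi] //=.
      by split=> -[_ nC]; split=> // ?; apply: nC; apply/(GC w).
    by split=> -[n _ Fn]; exists n => //; apply/(GF n w).
  move=> _ [i /= /negP iL [a _ <-]] w xi; rewrite !setTI /=.
  by rewrite paste_notin.
rewrite /= /wr_measure (eq_bigr (fun w => (wr_prob w eta * \1_B eta)%:E)).
  by rewrite sumEFin -mulr_suml wr_prob_sum mul1r.
move=> w _; rewrite diracE EFinM indicE; congr (_ * _%:R%:E)%E; congr nat_of_bool.
by apply/idP/idP => /set_mem Bw; apply/mem_set; apply/(inv w).
Qed.

Section consistency.
Variables (D L : {fset site d}) (DL : (D `<=` L)%fset).

Lemma wr_exponent_swap (xi xi' : config d) : (forall i, i \notin D -> xi i = xi' i) ->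
  wr_exponent L xi + wr_exponent D xi' = wr_exponent L xi' + wr_exponent D xi.
Proof.
move=> xi_eq.
suff [K HK] : exists K, forall x, x = xi \/ x = xi' ->
    wr_exponent L x = wr_exponent D x + K.
  by rewrite !HK; [ring|right|left].
pose E x (e : {fset site d}) : R := (\prod_(i <- e) spin_val (x i) == -1)%:R.
pose V (x : config d) i : R :=
  ln lambda * (spin_val (x i))%:~R ^+ 2 + h * (spin_val (x i))%:~R.
exists (- beta * (\sum_(e \in bedges L `&` ~` bedges D) E xi e)
  + \sum_(i <- L | i \notin D) V xi i) => x xE.
have xD i : i \notin D -> x i = xi i by case: xE => -> // /xi_eq ->.
rewrite /wr_exponent (fsbigID (bedges D)) /=; last exact: finite_bedges.
have -> : bedges L `&` bedges D = bedges D.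
  apply/setIidPr => e [i [j [-> ij /fset0Pn[k]]]]; rewrite inE => /andP[ke kD].
  exists i, j; split => //; apply/fset0Pn; exists k; rewrite inE ke.
  exact: (fsubsetP DL).
rewrite [X in _ = _ + X]addrC.
have -> : \sum_(e \in bedges L `&` ~` bedges D) E x e =
          \sum_(e \in bedges L `&` ~` bedges D) E xi e.
  apply: eq_fsbigr => e /set_mem [[i [j [-> ij _]]] nD].
  rewrite /E; congr (nat_of_bool (_ == _))%:R.
  apply: eq_big_seq => k ke; congr spin_val; apply: xD; apply/negP => kD.
  by apply: nD; exists i, j; split => //; apply/fset0Pn; exists k; rewrite inE ke.
rewrite (bigID (fun i => i \in D))/=.
have -> : \sum_(i <- L | i \in D) V x i = \sum_(i <- D) V x i.
  apply: eq_fbigl_cond => i; rewrite !inE andbT.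
  by apply/andP/idP => [[]//|iD]; split => //; exact: (fsubsetP DL).
have -> : \sum_(i <- L | i \notin D) V x i = \sum_(i <- L | i \notin D) V xi i.
  by apply: eq_bigr => i iD; rewrite /V xD.
rewrite /E /V; ring.
Qed.

Let splice (w : {ffun L -> spin}) (v : {ffun D -> spin}) : {ffun L -> spin} :=
  [ffun k => if insub (val k) is Some m then v m else w k].
Let restr (w : {ffun L -> spin}) : {ffun D -> spin} := [ffun m => w (fincl DL m)].
Let swap (p : {ffun L -> spin} * {ffun D -> spin}) := (splice p.1 p.2, restr p.1).

Let paste_splice w v eta : paste v (paste w eta) = paste (splice w v) eta.
Proof.
apply/funext => i; have [iL|iL] := boolP (i \in L); last first.
  by rewrite !paste_notin//; apply: contra iL; exact: (fsubsetP DL).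
rewrite [RHS](paste_in _ _ iL) ffunE /=; have [iD|iD] := boolP (i \in D).
  by rewrite paste_in insubT.
by rewrite paste_notin// insubN// paste_in.
Qed.

Let swapK : involutive swap.
Proof.
move=> [w v]; rewrite /swap /=; congr pair; apply/ffunP => k; rewrite !ffunE.
  have [kD|kD] := boolP (val k \in D); last by rewrite !insubN.
  by rewrite insubT ffunE; congr (w _); exact: val_inj.
have kD : val (fincl DL k) \in D by exact: fsvalP.
by rewrite (insubT (fun x => x \in D) kD); congr (v _); exact: val_inj.
Qed.

Lemma wr_consistent (A : set (confT d)) : measurable A -> forall eta,
  (\int[wr_kernel L eta]_(x in setT) wr_kernel D x A)%E = wr_kernel L eta A.
Proof.
move=> mA eta.
have mk : measurable_fun [set: confT d] (fun x : confT d => wr_kernel D x A).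
  move=> _ Y mY; rewrite setTI.
  have := measurable_kernel (wr_kernel D) A mA measurableT Y mY; rewrite setTI.
  apply: smallest_sub; first exact: smallest_sigma_algebra.
  by move=> _ [i _ [a _ <-]]; rewrite setTI; exact: (@coord_measurable d setT).
rewrite (integral_wr_measure eta mk)//.
rewrite /= /wr_measure.
under eq_bigr do under eq_bigr do rewrite diracE -EFinM.
under eq_bigr do rewrite sumEFin -EFinM.
under [RHS]eq_bigr do rewrite diracE -EFinM.
rewrite !sumEFin; congr EFin.
under eq_bigr do rewrite mulr_sumr.
rewrite pair_big /= (reindex_inj (inv_inj swapK)) /=.
rewrite (eq_bigr (fun p : {ffun L -> spin} * {ffun D -> spin} =>
  wr_prob p.2 (paste p.1 eta) * (wr_prob p.1 eta * (paste p.1 eta \in A)%:R))).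
  rewrite -(pair_big predT predT (fun w v => wr_prob v (paste w eta) *
    (wr_prob w eta * (paste w eta \in A)%:R))) /=.
  by apply: eq_bigr => w _; rewrite -mulr_suml wr_prob_sum mul1r.
move=> [w v] _ /=; rewrite paste_splice.
have -> : splice (splice w v) (restr w) = w by have [] := swapK (w, v).
rewrite mulrA [RHS]mulrA; congr (_ * _).
have agree : forall i, i \notin D -> paste w eta i = paste (splice w v) eta i.
  by move=> i iD; rewrite -paste_splice (paste_notin v).
have ZE : wr_Z D (paste (splice w v) eta) = wr_Z D (paste w eta).
  apply: eq_bigr => u _; rewrite /wr_weight; congr (expR (wr_exponent _ _)).
  apply/funext => i; have [iD|iD] := boolP (i \in D); first by rewrite !paste_in.
  by rewrite !(paste_notin u)// agree.
rewrite /wr_prob ZE /wr_weight !paste_splice.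
have -> : splice (splice w v) (restr w) = w by have [] := swapK (w, v).
rewrite mulrACA [RHS]mulrACA -!expRD -(wr_exponent_swap agree).
by rewrite [in RHS]addrC [X in _ = _ * X]mulrC.
Qed.

End consistency.

Definition wr_spec : specification R d :=
  Specification wr_proper wr_consistent.

End SoftCoreWR.

Arguments wr_spec {R} d beta lambda h.

(* Main.v *)
From HB Require Import structures.
Require Import Defs.
From mathcomp Require Import all_boot all_order all_algebra finmap.
From mathcomp Require Import zify ring lra.
From mathcomp Require Import all_classical all_reals all_analysis measurable_realfun.
From Stdlib Require Import Relations.

Set Implicit Arguments.
Unset Strict Implicit.
Unset Printing Implicit Defensive.
Import numFieldNormedType.Exports.
Import Order.TTheory GRing.Theory Num.Theory.
Local Open Scope classical_set_scope.
Local Open Scope ring_scope.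

(** The proof is a Peierls argument in boxes with boundary condition all plus,
    uniform over all [beta] and [lambda] for which both [expR beta] and
    [lambda] are at least some constant K.

    Contours. Let [xi] be plus outside a box and not plus at the origin. The set
    [outer xi] consists of the plus sites reached from outside the box by jumps
    of l1-length at most two between plus sites, [inner xi] is the
    nearest-neighbour component of the origin in the complement of [outer xi],
    and [contour xi] is the inner boundary of [inner xi]. The usual difficulty
    with the Widom-Rowlinson model is that a zero on a contour may separate two
    plus regions as well as a plus from a minus region, so that it cannot always
    be given a sign after the inside has been flipped. Jumps of length two remove
    it: a plus neighbour inside of a contour site would be at distance at most
    two from an outer plus, hence outer itself. So contour sites carry 0 or
    minus, their inner neighbours carry 0 or minus, and their other neighbours
    are plus. Consequently [erase], which puts plus on the contour and flips the
    remaining inner spins, creates no plus-minus bond, and every contour site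
    gains a factor at least K: a zero becomes a plus, which is worth [lambda],
    and a minus gives up a conflict with an outer plus, which is worth
    [expR beta] ([erase_gain]).

    Counting. A configuration is recovered from its image under [erase], its
    contour, the spins there, and the knowledge of which neighbours of contour
    sites are inner ([erase_inj]). Since the inner set is connected and its
    complement is connected for jumps of length two, the contour is connected
    for such jumps too ([inner_bd_connected]); this is the topological
    heart of the matter and rests on the vanishing of the first cohomology of the
    lattice ([discrete_poincare]). A contour of n sites is therefore covered by a
    closed walk with 2n - 1 points ([covering_walk]). It meets both half-axes of
    a coordinate line, so that the walk can start on this line less than 4n away
    from the origin. Hence there are at most exponentially many contours of size
    n, and summing a geometric series bounds by 1/3 the probability that the
    origin is not plus ([peierls_bound]).

    Infinite volume. Along an ultrafilter on the sizes of the boxes the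
    probabilities of all cylinder sets converge; by compactness of the space of
    configurations the limits extend to a probability measure
    ([cylinder_limit_measure]), which is a Gibbs measure because the interaction
    has finite range ([gibbs_limit]). With plus boundary condition the limit
    gives probability at least 2/3 to a plus at the origin. As h = 0, the
    spin-flip symmetry shows that with minus boundary condition the limit gives
    it probability at most 1/3, so the two Gibbs measures differ. *)

(** * Nearest-neighbour geometry of the lattice *)

Definition dir d : Type := ('I_d * bool)%type.
HB.instance Definition _ d := Finite.on (dir d).

Definition vec d (a : dir d) : site d := (-1) ^+ a.2 *: delta_mx 0 a.1.
Definition ovec d (o : option (dir d)) : site d := if o is Some a then vec a else 0.

Lemma vecE d (a : dir d) k : vec a 0 k = (-1) ^+ a.2 * (k == a.1)%:R.
Proof. by rewrite !mxE eqxx. Qed.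

Lemma vecN d (i : 'I_d) b : vec (i, ~~ b) = - vec (i, b).
Proof. by apply/rowP => k; rewrite vecE mxE vecE; case: b => /=; ring. Qed.

Lemma ovecN d (o : option (dir d)) : exists o', ovec o' = - ovec o.
Proof.
case: o => [[i b]|]; last by exists None; rewrite oppr0.
by exists (Some (i, ~~ b)); exact: vecN.
Qed.

Lemma adj_vecP d (x y : site d) : reflect (exists a, y = x + vec a) (adj x y).
Proof.
apply: (iffP idP) => [/eqP n1|[a ->]]; last first.
  rewrite /adj /norm1 (bigD1 a.1)//= big1 ?addr0.
    by rewrite !mxE opprD addNKr normrN !eqxx mulr1 normrX normrN1 expr1n.
  by move=> k ka; rewrite !mxE (negbTE ka) andbF mulr0 addr0 subrr normr0.
have [k uk] : exists k, (x - y) 0 k != 0.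
  apply/existsP; apply: contra_eqT n1 => /existsPn u0.
  by rewrite /norm1 big1// => k _; have := u0 k; rewrite negbK => /eqP ->; rewrite normr0.
move: n1; rewrite /norm1 (bigD1 k)//= => n1.
have rest0 : \sum_(i < d | i != k) `|(x - y) 0 i| = 0.
  apply/eqP; rewrite eq_le sumr_ge0 ?andbT// -(lerD2l `|(x - y) 0 k|) n1 addr0.
  lia.
have {}rest0 j : j != k -> (x - y) 0 j = 0.
  move=> jk; apply/eqP; rewrite -normr_eq0; apply/eqP.
  by apply: (psumr_eq0P _ rest0 jk) => i _; exact: normr_ge0.
exists (k, 0 < (x - y) 0 k); apply/rowP => j; rewrite mxE vecE /=.
have := n1; have [->|jk] := eqVneq j k; last first.
  by have := rest0 _ jk; rewrite !mxE mulr0 addr0 => /eqP; rewrite subr_eq0 => /eqP.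
rewrite (eq_bigr (fun=> 0)) ?big1_eq; last by move=> i ik; rewrite rest0 ?normr0.
by rewrite !mxE mulr1; case: ltP; move: (x 0 k) (y 0 k) => u v c /=; rewrite addr0 ?expr0 ?expr1; clear -c; lia.
Qed.

Lemma adjC d (x y : site d) : adj x y = adj y x.
Proof. by rewrite /adj /norm1; under eq_bigr do rewrite !mxE distrC;
  under [in RHS]eq_bigr do rewrite !mxE. Qed.

(** Distance at most two in the l1 norm, written with two explicit unit steps
    so that a step of a walk is a letter of a finite alphabet. *)
Definition near2 d (x y : site d) : Prop :=
  exists o o', y = x + ovec o + ovec o'.

Lemma near2_refl d (x : site d) : near2 x x.
Proof. by exists None, None; rewrite !addr0. Qed.

Lemma near2_sym d (x y : site d) : near2 x y -> near2 y x.
Proof.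
move=> [a [b ->]]; have [p pE] := ovecN a; have [p' pE'] := ovecN b.
by exists p', p; rewrite pE pE' addrK addrK.
Qed.

Lemma adj_near2 d (x y : site d) : adj x y -> near2 x y.
Proof. by move=> /adj_vecP[a ->]; exists (Some a), None; rewrite addr0. Qed.

Lemma adj2_near2 d (x y z : site d) : adj x y -> adj y z -> near2 x z.
Proof. by move=> /adj_vecP[a ->] /adj_vecP[b ->]; exists (Some a), (Some b). Qed.

Lemma near2P d (x y : site d) : near2 x y ->
  [\/ x = y, adj x y | exists2 z, adj x z & adj z y].
Proof.
move=> [[a|] [[b|] ->]] /=; rewrite ?addr0.
- by apply: Or33; exists (x + vec a); apply/adj_vecP; [exists a|exists b].
- by apply: Or32; apply/adj_vecP; exists a.
- by apply: Or32; apply/adj_vecP; exists b.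
- exact: Or31.
Qed.

(** * Chains of a relation inside a set *)

(** All points of a chain lie in [S], except that a chain of length zero may start
    anywhere. *)
Definition chain T (r : T -> T -> Prop) (S : set T) : T -> T -> Prop :=
  clos_refl_trans_n1 T (fun x y => [/\ S x, S y & r x y]).

Lemma chain_refl T (r : T -> T -> Prop) S x : chain r S x x.
Proof. exact: rtn1_refl. Qed.

Lemma chain_step T (r : T -> T -> Prop) (S : set T) x y z :
  chain r S x y -> S y -> S z -> r y z -> chain r S x z.
Proof. by move=> cxy Sy Sz ryz; apply: (Relation_Operators.rtn1_trans _ _ _ y). Qed.

Lemma chain1 T (r : T -> T -> Prop) (S : set T) x y :
  S x -> S y -> r x y -> chain r S x y.
Proof. by apply: chain_step; exact: chain_refl. Qed.

Lemma chain_trans T (r : T -> T -> Prop) (S : set T) x y z :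
  chain r S x y -> chain r S y z -> chain r S x z.
Proof.
move=> cxy; elim=> // u v [Su Sv ruv] _ IH; exact: (chain_step IH).
Qed.

Lemma chain_sym T (r : T -> T -> Prop) (S : set T) x y :
  (forall u v, r u v -> r v u) -> chain r S x y -> chain r S y x.
Proof.
move=> rs; elim=> [|u v [Su Sv ruv] _ IH]; first exact: chain_refl.
by apply: chain_trans IH; apply: chain1 => //; exact: rs.
Qed.

Lemma sub_chain T (r r' : T -> T -> Prop) (S S' : set T) x y :
  (forall u v, S u -> S v -> r u v -> r' u v) -> S `<=` S' ->
  chain r S x y -> chain r' S' x y.
Proof.
move=> rr' SS'; elim=> [|u v [Su Sv ruv] _ IH]; first exact: chain_refl.
by apply: (chain_step IH); [exact: SS'|exact: SS'|exact: rr'].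
Qed.

Lemma chain_mem T (r : T -> T -> Prop) (S : set T) x y : chain r S x y -> S x -> S y.
Proof. by elim=> // u v [_ Sv _]. Qed.

Lemma chain_eq T U (r : T -> T -> Prop) (S : set T) (g : T -> U) x y :
  (forall u v, S u -> S v -> r u v -> g u = g v) -> chain r S x y -> g x = g y.
Proof. by move=> gE; elim=> // u v [Su Sv ruv] _ ->; exact: gE. Qed.

(** * Discrete Poincare lemma *)

Section Poincare.
Variable V : zmodType.

(** A discrete antiderivative on all of Z, which vanishes at 0; on the negative
    side the sum runs over [n <= k < 0] with the opposite sign. *)
Definition antidiff (a : int -> V) (n : int) : V :=
  match n with
  | Posz m => \sum_(k < m) a k%:Z
  | Negz m => - \sum_(k < m.+1) a (Negz k)
  end.

Lemma antidiffS a n : antidiff a (n + 1) = antidiff a n + a n.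
Proof.
case: n => [m|[|m]].
- by rewrite -PoszD addn1 /= big_ord_recr.
- by rewrite /= big_ord0 big_ord_recl big_ord0 addr0 addNr.
- have -> : Negz m.+1 + 1 = Negz m by lia.
  by rewrite /= [in RHS]big_ord_recr /= opprD -addrA addNr addr0.
Qed.

Lemma int_step_ind (P : int -> Prop) :
  P 0 -> (forall n, P n <-> P (n + 1)) -> forall n, P n.
Proof.
move=> P0 PS; case; elim=> [|n IH] //.
- rewrite (_ : Posz n.+1 = n%:Z + 1); first exact: (proj1 (PS _) IH).
  by lia.
- by apply: (proj2 (PS _)); have -> : Negz 0 + 1 = 0 by lia.
- by apply: (proj2 (PS _)); have -> : Negz n.+1 + 1 = Negz n by lia.
Qed.

Lemma antidiff_telescope a a' b n : (forall m, a' m - a m = b (m + 1) - b m) ->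
  antidiff a' n - antidiff a n = b n - b 0.
Proof.
move=> H; pose P n := antidiff a' n - antidiff a n = b n - b 0.
apply: (@int_step_ind P) => [|{}n]; rewrite /P; first by rewrite /= !big_ord0 !subrr.
rewrite !antidiffS opprD addrACA H; split=> [->|].
  by rewrite addrC addrA subrK.
by move=> /(canRL (addrK _)) ->; rewrite opprB addrC addrA subrK.
Qed.

Variable d : nat.
Let e (i : 'I_d) : site d := vec (i, false).

Let eE i k : e i 0 k = (k == i)%:R.
Proof. by rewrite vecE /= expr0 mul1r. Qed.

(* The point reached after the first [k] directions on the path from the origin to
   [x] which moves parallel to the coordinate axes one after the other. *)
Let trunc (k : nat) (x : site d) : site d := \row_j (if (j < k)%N then x 0 j else 0).

(** The hypothesis says that [f], seen as a 1-cochain on the edges, sums to zero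
    around every unit square. The potential at [x] is the sum of [f] along the
    path from the origin through the points [trunc k x]; its increment telescopes because the squares allow the last step in direction
    [i] to be slid along the path. *)
Lemma discrete_poincare (f : site d -> 'I_d -> V) :
  (forall x i j, f x i + f (x + e i) j = f x j + f (x + e j) i) ->
  exists g : site d -> V, forall x i, g (x + e i) - g x = f x i.
Proof.
move=> fcl.
exists (fun x => \sum_(k < d) antidiff (fun m => f (trunc k x + m *: e k) k) (x 0 k)).
move=> x i; rewrite -sumrB.
(* [h k] is the value of [f] at the k-th corner in direction [i]: zero up to the
   i-th corner, since the paths to [x] and [x + e i] agree so far. *)
pose h (k : nat) : V := if (k <= i)%N then 0 else f (trunc k x) i.
have step (k : 'I_d) : trunc k x + x 0 k *: e k = trunc k.+1 x.
  apply/rowP => j; rewrite mxE [trunc k.+1 x 0 j]mxE mxE [in X in _ + X]mxE eE.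
  have [->|jk] := eqVneq j k; first by rewrite ltnn ltnSn mulr1 add0r.
  have {}jk : (j == k :> nat) = false by apply/negbTE.
  by rewrite [in RHS]ltnS [in RHS]leq_eqVlt jk mulr0 addr0.
have trunc_le (k : 'I_d) (y : site d) (l : 'I_d) :
    (k <= l)%N -> trunc k (y + e l) = trunc k y.
  move=> kl; apply/rowP => j; rewrite mxE [RHS]mxE mxE eE; case: ifP => // jk.
  by rewrite (_ : (j == l) = false) ?addr0// -val_eqE /= ltn_eqF// (leq_trans jk).
rewrite (eq_bigr (fun k : 'I_d => h k.+1 - h k)); last first.
  move=> k _; have [ki|ik|/val_inj ki] := ltngtP k i.
  - rewrite trunc_le 1?ltnW// [(x + e i) 0 k]mxE eE -val_eqE /= ltn_eqF// addr0.
    by rewrite subrr /h ki (ltnW ki) subrr.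
  - have -> : trunc k (x + e i) = trunc k x + e i.
      apply/rowP => j; rewrite mxE [RHS]mxE [in RHS]mxE mxE eE.
      case: ifP => // jk; rewrite -val_eqE /= gtn_eqF ?addr0//.
      by rewrite (leq_trans ik)// leqNgt jk.
    rewrite [(x + e i) 0 k]mxE eE -val_eqE /= gtn_eqF// addr0.
    rewrite (@antidiff_telescope _ _ (fun m => f (trunc k x + m *: e k) i)).
      by rewrite scale0r addr0 step /h !(leqNgt _ i) ik (ltnW ik : (i < k.+1)%N).
    move=> m /=; rewrite scalerDl scale1r [X in f X k - _]addrAC addrA.
    set Y := trunc k x + _.
    rewrite -[f (Y + e i) k](addKr (f Y i)) -fcl [f Y k + _]addrC addrA addrK.
    by rewrite addrC.
  - rewrite -ki [(x + e k) 0 k]mxE eE eqxx trunc_le//.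
    by rewrite antidiffS addrAC subrr add0r step /h -ki leqnn ltnn subr0.
rewrite -(big_mkord xpredT (fun k => h k.+1 - h k)) telescope_sumr// /h leq0n subr0.
rewrite leqNgt ltn_ord /=; congr (f _ i).
by apply/rowP => j; rewrite mxE ltn_ord.
Qed.

End Poincare.

(** * Connectedness of boundaries *)

Definition inner_bd d (A : set (site d)) : set (site d) :=
  [set x | A x /\ exists2 y, adj x y & ~ A y].

Section boundary.
Variables (d : nat) (A : set (site d)).
Hypothesis Aconn : forall x y, A x -> A y -> chain (fun u v => adj u v) A x y.
Hypothesis Acconn : forall x y, ~ A x -> ~ A y -> chain (@near2 d) (~` A) x y.

Section component.
Variable b0 : site d.
Hypothesis Bb0 : inner_bd A b0.

Let B1 : set (site d) := [set x | inner_bd A x /\ chain (@near2 d) (inner_bd A) b0 x].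

(* Up to sign the coboundary of the indicator function of [A], kept only on the edges whose
   end in [A] belongs to the component [B1] of the inner boundary. *)
Let c (x y : site d) : int :=
  `[< B1 x /\ ~ A y >]%:R - `[< B1 y /\ ~ A x >]%:R.

Let B1A x : B1 x -> A x. Proof. by case=> -[]. Qed.

Let cC x y : c y x = - c x y. Proof. by rewrite /c opprB. Qed.

Let c0 x y : (A x <-> A y) -> c x y = 0.
Proof.
move=> Axy; rewrite /c; have F u v : (A u <-> A v) -> `[< B1 u /\ ~ A v >] = false.
  by move=> uv; apply/asboolP => -[/B1A /uv].
by rewrite !F ?subrr//; split=> /Axy.
Qed.

Let cA x y : A x -> ~ A y -> c x y = `[< B1 x >]%:R.
Proof.
move=> Ax nAy; rewrite /c (_ : `[< B1 y /\ _ >] = false) ?subr0.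
  by congr (nat_of_bool _)%:R; apply/asboolP/asboolP => [[]|].
by apply/asboolP => -[/B1A].
Qed.

Let e (i : 'I_d) : site d := vec (i, false).

(* The corners of a square are pairwise at distance at most two, so the boundary
   sites among them all belong to [B1] or all avoid it; on the square [c] is then
   the full coboundary or zero. *)
Let c_closed x i j :
  c x (x + e i) + c (x + e i) (x + e i + e j) = c x (x + e j) + c (x + e j) (x + e j + e i).
Proof.
have ai y k : adj y (y + e k) by apply/adj_vecP; exists (k, false).
pose Q := [set x; x + e i; x + e j; x + e i + e j].
have Qnear p q : Q p -> Q q -> near2 p q.
  have n1 y k : near2 y (y + e k) by exact/adj_near2.
  have n2 y k l : near2 y (y + e k + e l) by exact: adj2_near2 (ai _ _) (ai _ _).
  have n3 k l : near2 (x + e k) (x + e l).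
    by apply: (@adj2_near2 _ _ x); rewrite // adjC.
  have n4 k l : near2 (x + e k) (x + e l + e k) by rewrite addrAC.
  have n5 := near2_refl.
  by move=> [[[]|]|] -> [[[]|]|] ->; (try by []); apply: near2_sym.
have adjQ p q : Q p -> Q q -> adj p q ->
    c p q = `[< exists2 r, Q r & B1 r >]%:R * (`[< A p >]%:R - `[< A q >]%:R).
  move=> Qp Qq pq.
  have half u v : Q u -> adj u v -> A u -> ~ A v ->
      `[< B1 u >] = `[< exists2 r, Q r & B1 r >].
    move=> Qu uv Au nAv; apply/asboolP/asboolP => [|[r Qr [Br cr]]]; first by exists u.
    have Bu : inner_bd A u by split=> //; exists v.
    by split=> //; apply: (chain_step cr) => //; exact: Qnear.
  have [Ap|nAp] := pselect (A p); have [Aq|nAq] := pselect (A q).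
  - by rewrite c0 // (asboolT Ap) (asboolT Aq) subrr mulr0.
  - by rewrite cA// (asboolT Ap) (asboolF nAq) subr0 mulr1 (half p q).
  - rewrite cC cA// (asboolF nAp) (asboolT Aq) sub0r mulrN1 (half q p)//.
    by rewrite adjC.
  - by rewrite c0 // (asboolF nAp) (asboolF nAq) subrr mulr0.
have Q0 : Q x by do 3 left.
have Q1 : Q (x + e i) by do 2 left; right.
have Q2 : Q (x + e j) by left; right.
have Q3 : Q (x + e i + e j) by right.
have Q4 : Q (x + e j + e i) by rewrite addrAC.
by rewrite !adjQ// [x + e j + e i]addrAC; ring.
Qed.

(* A potential of [c] is constant on [A] and on its complement: a jump of length
   two in the complement over a site of [A] crosses two edges with the same end in
   [A], whose contributions cancel. Thus [c] takes the same value on all edges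
   leaving [A], and this value is 1 at [b0]. *)
Let B1_all x : inner_bd A x -> B1 x.
Proof.
move=> Bx.
have [g gE] := discrete_poincare c_closed.
have {}gE y z : adj y z -> g z - g y = c y z.
  move=> /adj_vecP[[i []] ->]; last exact: gE.
  rewrite (vecN i false : vec (i, true) = _).
  set t := y - _; have -> : y = t + e i by rewrite subrK.
  by rewrite cC -gE opprB.
have gA y z : A y -> A z -> adj y z -> g y = g z.
  by move=> Ay Az /gE; rewrite c0// => /subr0_eq.
have gnA y z : ~ A y -> ~ A z -> near2 y z -> g y = g z.
  move=> nAy nAz /near2P[-> //|/gE|[u /[!adjC y] /gE uy /gE uz]].
    by rewrite c0// => /subr0_eq.
  apply: (addIr (- g u)); rewrite uy uz; have [Au|nAu] := pselect (A u).
    by rewrite !cA.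
  by rewrite !c0.
have [Ab0 [y0 ay0 nAy0]] := Bb0; have [Ax [y ay nAy]] := Bx.
have := gE _ _ ay; rewrite cA//.
rewrite -(chain_eq gnA (Acconn nAy0 nAy)) -(chain_eq gA (Aconn Ab0 Ax)).
rewrite gE// cA// (asboolT (_ : B1 b0)); first by case: asboolP.
by split=> //; exact: chain_refl.
Qed.

Lemma inner_bd_connected0 x : inner_bd A x -> chain (@near2 d) (inner_bd A) b0 x.
Proof. by move=> /B1_all[]. Qed.

End component.

(** The analogue in the lattice of the connectedness of the boundary of a connected
    set with connected complement. Since the complement is only assumed connected
    for jumps of length two, so is the boundary. *)
Lemma inner_bd_connected x y : inner_bd A x -> inner_bd A y ->
  chain (@near2 d) (inner_bd A) x y.
Proof. by move=> Bx; exact: (inner_bd_connected0 Bx). Qed.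

End boundary.

(** * Boxes *)

Definition box d (n : nat) : {fset site d} :=
  [fset (\row_k ((f k : nat)%:Z - n%:Z) : site d) | f : {ffun 'I_d -> 'I_(n.*2.+1)} in predT]%fset.

Lemma boxP d n (x : site d) : reflect (forall k, `|x 0 k| <= n%:Z) (x \in box d n).
Proof.
apply: (iffP (imfsetP _ _ _ _)) => [[f _ ->] k|xn].
  by rewrite mxE; move: (nat_of_ord (f k)) (ltn_ord (f k)) => m; lia.
have lt k : (absz (x 0 k + n%:Z)%R < n.*2.+1)%N by have := xn k; lia.
exists [ffun k => Ordinal (lt k)] => //.
by apply/rowP => k; rewrite mxE ffunE /=; have := xn k; lia.
Qed.

Lemma box_notin d n (x : site d) k : n%:Z < `|x 0 k| -> x \notin box d n.
Proof. by move=> nk; apply/boxP => /(_ k); lia. Qed.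

Lemma sub_box_near (d : nat) (L : {fset site d}) : \forall n \near \oo, (L `<=` box d n)%fset.
Proof.
pose N : nat := (\sum_(x <- L) \sum_(k < d) `|x ord0 k|)%N.
exists N => // n /= Nn; apply/fsubsetP => x xL; apply/boxP => k.
suff : (`|x ord0 k| <= N)%N by move: (x ord0 k) => u; lia.
rewrite /N (big_fsetD1 x)//= (bigD1 k)//= -addnA; exact: leq_addr.
Qed.

Definition set_coord d (x : site d) (k : 'I_d) (v : int) : site d :=
  \row_j (if j == k then v else x 0 j).

Lemma chain_line d (S : set (site d)) x k v :
  (forall v, S (set_coord x k v)) -> chain (fun u v => adj u v) S x (set_coord x k v).
Proof.
move=> HS.
have adjS u : adj (set_coord x k u) (set_coord x k (u + 1)).
  apply/adj_vecP; exists (k, false); apply/rowP => j.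
  by rewrite mxE [RHS]mxE mxE vecE; case: eqP => _; rewrite ?addr0// expr0 mul1r.
pose Q v := chain (fun u v => adj u v) S (set_coord x k 0) (set_coord x k v).
have allQ t : Q t.
  apply: (@int_step_ind Q) t => [|t]; first exact: chain_refl.
  by split=> c; apply: (chain_step c) => //; rewrite adjC.
rewrite -[X in chain _ _ X](_ : set_coord x k (x 0 k) = x).
  by apply: chain_trans (allQ v); apply: chain_sym (allQ _) => a b; rewrite adjC.
by apply/rowP => j; rewrite mxE; case: eqP => // ->.
Qed.

(** From a site with a large i-th coordinate every other coordinate can be moved
    freely without entering the box; two coordinates are needed to bring them all to
    the common value [n.+1]. *)
Lemma box_exterior_connected d n (x y : site d) : (2 <= d)%N ->
  x \notin box d n -> y \notin box d n ->
  chain (fun u v => adj u v) (~` [set` box d n]) x y.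
Proof.
move=> d2 xn yn.
pose top : site d := const_mx n.+1%:Z.
suff H z : z \notin box d n -> chain (fun u v => adj u v) (~` [set` box d n]) z top.
  apply: chain_trans (H x xn) _; apply: chain_sym (H y yn) => a b.
  by rewrite adjC.
have move1 (u : site d) i k v : i != k -> n%:Z < `|u 0 i| ->
    chain (fun u v => adj u v) (~` [set` box d n]) u (set_coord u k v).
  move=> ik ui; apply: chain_line => w /=; apply/negP; apply: (@box_notin _ _ _ i).
  by rewrite mxE (negbTE ik).
move=> /boxP zn; have [i zi] : exists i, n%:Z < `|z 0 i|.
  apply/existsP; apply: contra_notT zn => /existsPn zn k.
  by rewrite leNgt zn.
have [j ij] : exists j : 'I_d, i != j.
  have d0 : (0 < d)%N by lia.
  have [i0|i0] := eqVneq (val i) 0%N.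
    by exists (Ordinal d2); rewrite -val_eqE /= i0.
  by exists (Ordinal d0); rewrite -val_eqE.
apply: (chain_trans (move1 z i j n.+1%:Z ij zi)).
set z' := set_coord z j _.
have z'j : z' 0 j = n.+1%:Z by rewrite mxE eqxx.
pose F (s : seq 'I_d) : site d := \row_l (if l \in s then n.+1%:Z else z' 0 l).
have chF (s : seq 'I_d) : chain (fun u v => adj u v) (~` [set` box d n]) z' (F s).
  elim: s => [|l s IH].
    by rewrite (_ : F [::] = z'); [exact: chain_refl|apply/rowP => l; rewrite mxE].
  have FE : F (l :: s) = set_coord (F s) l n.+1%:Z.
    by apply/rowP => k; rewrite !mxE inE; case: eqP.
  apply: (chain_trans IH); have [jl|jl] := eqVneq j l; last first.
    by rewrite FE; apply: (move1 _ j) => //; rewrite mxE z'j; case: ifP; lia.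
  rewrite FE (_ : set_coord _ _ _ = F s); first exact: chain_refl.
  apply/rowP => k; rewrite mxE; case: eqP => // ->.
  by rewrite mxE -jl z'j; case: ifP.
rewrite (_ : top = F (enum 'I_d)); first exact: chF.
by apply/rowP => k; rewrite !mxE mem_enum.
Qed.

Lemma ray_inner_bd d (A : set (site d)) (a : dir d) (x : site d) m :
  A x -> ~ A (x + vec a *+ m) -> exists k, inner_bd A (x + vec a *+ k).
Proof.
move=> Ax; elim: m => [|m IH]; first by rewrite mulr0n addr0.
have [Am|nAm] := pselect (A (x + vec a *+ m)); last by move=> _; exact: IH.
move=> nAm; exists m; split=> //; exists (x + vec a *+ m.+1) => //.
by apply/adj_vecP; exists a; rewrite mulrSr addrA.
Qed.

(** * Closed walks covering a connected set *)

Lemma chain_exit T (r : T -> T -> Prop) (S V : set T) x y :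
  chain r S x y -> V x -> ~ V y -> exists u v, [/\ S v, V u, ~ V v & r u v].
Proof.
move=> c Vx; elim: c => // u v [Su Sv ruv] _ IH nVv.
by have [Vu|nVu] := pselect (V u); [exists u, v|exact: IH].
Qed.

(** The depth-first traversal of a spanning tree: the walk is extended by an
    excursion of two steps to a new point as long as one is left. *)
Lemma covering_walk (T : choiceType) (r : T -> T -> Prop) (B : {fset T}) b :
  (forall x y, r x y -> r y x) -> b \in B ->
  (forall x, x \in B -> chain r [set` B] b x) ->
  exists s : seq T, [/\ path (fun x y => `[< r x y >]) b s, (b :: s) =i B &
    (size s).+2 = (#|` B|).*2].
Proof.
move=> rs bB Bconn.
suff H m (V : {fset T}) (s : seq T) : path (fun x y => `[< r x y >]) b s ->
    (b :: s) =i V -> (size s).+2 = (#|` V|).*2 -> (V `<=` B)%fset ->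
    (#|` B| - #|` V|)%N = m ->
    exists s : seq T, [/\ path (fun x y => `[< r x y >]) b s, (b :: s) =i B &
      (size s).+2 = (#|` B|).*2].
  apply: (H _ [fset b]%fset [::]) erefl => //.
  - by move=> x; rewrite !inE.
  - by rewrite cardfs1.
  - by rewrite fsub1set.
elim: m V s => [|m IH] V s ps sV szs VB cB.
  have -> : B = V; last by exists s.
  by apply/esym/eqP; rewrite eqEfcard VB -subn_eq0 cB.
have [y0 y0B y0V] : exists2 y, y \in B & y \notin V.
  apply/fsubsetPn; apply: contra_eqN cB => /fsubset_leq_card.
  by rewrite -subn_eq0 => /eqP ->.
have bV : b \in V by rewrite -sV mem_head.
have [] := @chain_exit _ r _ [set` V] _ _ (Bconn _ y0B) bV (negP y0V).
move=> x [y [/= yB xV /negP yV rxy]].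
have xs : x \in b :: s by rewrite sV.
case/splitPl: xs ps sV szs => p1 p2 lp1 ps sV szs.
apply: (IH (y |` V)%fset (p1 ++ [:: y, x & p2])).
- move: ps; rewrite !cat_path lp1 /= => /andP[-> ->]; rewrite andbT /=.
  by apply/andP; split; apply/asboolP => //; exact: rs.
- move=> z; rewrite in_fset1U; have [->|zx] := eqVneq z x.
    by rewrite [x \in V]xV orbT !inE mem_cat !inE eqxx !orbT.
  rewrite -sV !inE !mem_cat !inE (negbTE zx) /=.
  by case: (z == b); case: (z == y); case: (z \in p1).
- by rewrite cardfsU1 yV size_cat /= !addnS -size_cat szs; lia.
- by apply/fsubsetP => z; rewrite in_fset1U => /orP[/eqP -> //|]; exact: (fsubsetP VB).
- by rewrite cardfsU1 yV; lia.
Qed.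

(** * Encoding near-walks by their steps *)

Definition step d : Type := (option (dir d) * option (dir d))%type.
HB.instance Definition _ d := Finite.on (step d).

Definition shift_by d (x : site d) (t : step d) : site d := x + ovec t.1 + ovec t.2.

(** A walk is determined by its starting point and the sequence of its steps, which
    are taken from a finite set. *)
Lemma walk_steps d (x : site d) s : path (fun x y => `[< near2 x y >]) x s ->
  exists2 t : seq (step d), size t = size s & s = scanl (@shift_by d) x t.
Proof.
elim: s x => [|y s IH] x /=; first by exists [::].
move=> /andP[/asboolP[a [b yE]] /IH[t tE sE]].
by exists ((a, b) :: t); rewrite /= ?tE// /shift_by -yE -sE.
Qed.

Lemma norm_vec d (a : dir d) k : `|vec a 0 k| <= 1.
Proof. by rewrite vecE normrM normrX normrN1 expr1n mul1r; case: eqP. Qed.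

Lemma norm_ovec d (o : option (dir d)) k : `|ovec o 0 k| <= 1.
Proof. by case: o => [a|]; [exact: norm_vec|rewrite mxE]. Qed.

Lemma walk_dist d (x y : site d) s k : path (fun x y => `[< near2 x y >]) x s ->
  y \in x :: s -> `|y 0 k - x 0 k| <= (size s).*2%:Z.
Proof.
elim: s x => [|z s IH] x /=; first by rewrite inE => _ /eqP ->; rewrite subrr.
move=> /andP[/asboolP[a [b zE]] ps]; rewrite inE => /orP[/eqP ->|].
  by rewrite subrr normr0.
move=> /(IH z ps); rewrite zE !mxE.
move: (norm_ovec a k) (norm_ovec b k).
by move: (ovec a 0 k) (ovec b 0 k) (y 0 k) (x 0 k) => p q r t; lia.
Qed.

(** * Spins *)

Fact spin1_subproof : (1 : int) \in [:: -1; 0; 1 : int]. Proof. by []. Qed.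
Fact spinN1_subproof : (-1 : int) \in [:: -1; 0; 1 : int]. Proof. by []. Qed.
Definition plus : spin := SeqSub spin1_subproof.
Definition minus : spin := SeqSub spinN1_subproof.

Lemma spin_val_inj : injective spin_val. Proof. exact: val_inj. Qed.

Variant spin_spec (s : spin) : int -> Prop :=
  | SpinPlus of s = plus : spin_spec s 1
  | SpinZero of spin_val s = 0 : spin_spec s 0
  | SpinMinus of s = minus : spin_spec s (-1).

Lemma spinP s : spin_spec s (spin_val s).
Proof.
have := ssvalP s; rewrite !inE -/(spin_val s) => /or3P[] /eqP sE.
- by rewrite sE; constructor; exact: spin_val_inj.
- by rewrite sE; constructor.
- by rewrite sE; constructor; exact: spin_val_inj.
Qed.

Definition flip (s : spin) : spin :=
  if spin_val s == 1 then minus else if spin_val s == -1 then plus else s.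

Lemma spin_val_flip s : spin_val (flip s) = - spin_val s.
Proof. by rewrite /flip; case: (spinP s) => //= ->. Qed.

Lemma flipK : involutive flip.
Proof. by move=> s; apply: spin_val_inj; rewrite !spin_val_flip opprK. Qed.

(** * The contour of a configuration *)

Section contour.
Variables (d : nat) (L : {fset site d}).

(** The chain of length zero puts every site outside [L] in [outer xi]; the
    configurations of interest are plus there. *)
Definition outer (xi : config d) : set (site d) :=
  [set x | exists2 y, y \notin L & chain (@near2 d) [set z | xi z = plus] y x].

Definition inner (xi : config d) : set (site d) :=
  [set x | ~ outer xi 0 /\ chain (fun u v => adj u v) (~` outer xi) 0 x].

Definition contour (xi : config d) : set (site d) := inner_bd (inner xi).

Definition erase (xi : config d) : config d := fun x =>
  if `[< contour xi x >] then plus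
  else if `[< inner xi x >] then flip (xi x) else xi x.

Section properties.
Variables (xi : config d) (Lxi : forall x, x \notin L -> xi x = plus).

Lemma outer_plus x : outer xi x -> xi x = plus.
Proof. by move=> [y yL c]; apply: (chain_mem c); exact: Lxi. Qed.

Lemma outer_near x y : outer xi x -> near2 x y -> xi y = plus -> outer xi y.
Proof.
by move=> ox xy yp; have xp := outer_plus ox; case: ox => z zL c; exists z => //;
  exact: (chain_step c).
Qed.

Lemma notin_outer x : x \notin L -> outer xi x.
Proof. by move=> xL; exists x => //; exact: chain_refl. Qed.

Lemma inner_not_outer x : inner xi x -> ~ outer xi x.
Proof. by move=> [out0 c]; exact: (chain_mem c). Qed.

Lemma inner_in x : inner xi x -> x \in L.
Proof. by move=> /inner_not_outer; apply: contra_notT; exact: notin_outer. Qed.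

Lemma inner0 : xi 0 != plus -> inner xi 0.
Proof.
move=> x0; split; last exact: chain_refl.
by move=> /outer_plus /eqP; rewrite (negbTE x0).
Qed.

Lemma inner_adj x y : inner xi x -> adj x y -> ~ outer xi y -> inner xi y.
Proof.
move=> ix xy oy; have := inner_not_outer ix; case: ix => out0 c ox; split=> //.
exact: (chain_step c).
Qed.

Lemma adj_outer x y : inner xi x -> adj x y -> ~ inner xi y -> outer xi y.
Proof. by move=> ix xy; apply: contra_notP => /(inner_adj ix xy). Qed.

Lemma contour_inner x : contour xi x -> inner xi x. Proof. by case. Qed.

(** The reason for the jumps of length two in [outer]: [x] has an outer
    neighbour, which is within distance two of [y]. *)
Lemma contour_near_not_plus x y : contour xi x -> x = y \/ adj x y -> inner xi y ->
  xi y != plus.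
Proof.
move=> [ix [z xz iz]] xy iy; apply/eqP => yp; apply: (inner_not_outer iy).
apply: outer_near yp; first exact: (adj_outer ix xz iz).
by case: xy => [<-|]; [apply: adj_near2|apply: adj2_near2]; rewrite // adjC.
Qed.

Lemma inner_connected x y : inner xi x -> inner xi y ->
  chain (fun u v => adj u v) (inner xi) x y.
Proof.
suff H z : inner xi z -> chain (fun u v => adj u v) (inner xi) 0 z.
  move=> /H cx /H cy; apply: chain_trans cy; apply: chain_sym cx => u v.
  by rewrite adjC.
move=> [out0]; elim=> [|u v [nu nv uv] cu IH]; first exact: chain_refl.
have iu : inner xi u by split.
by apply: (chain_step IH) => //; exact: (inner_adj iu).
Qed.

Hypothesis Lconn : forall x y, x \notin L -> y \notin L ->
  chain (fun u v => adj u v) (~` [set` L]) x y.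

(** An outer site is joined to the exterior of [L] by outer sites. Any other site
    outside of [inner xi] is led to [outer xi] by a ray, which cannot meet
    [inner xi] before since the latter is a whole component. *)
Lemma inner_co_connected x y : (0 < d)%N -> ~ inner xi x -> ~ inner xi y ->
  chain (@near2 d) (~` inner xi) x y.
Proof.
move=> d0.
have outer_conn u v : outer xi u -> outer xi v -> chain (@near2 d) (~` inner xi) u v.
  have H w : outer xi w -> exists2 z, z \notin L & chain (@near2 d) (~` inner xi) z w.
    move=> [z zL c]; exists z => //.
    have zo := notin_outer zL.
    elim: c => [|a b [/= ap bp ab] ca IH]; first exact: chain_refl.
    have oa : outer xi a by exists z.
    have ob : outer xi b by exact: (outer_near oa).
    by apply: (chain_step IH) => // /inner_not_outer.
  move=> /H[z zL cz] /H[w wL cw]; apply: chain_trans cw.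
  apply: (chain_trans (chain_sym (@near2_sym d) cz)).
  apply: sub_chain (Lconn zL wL) => [a b _ _|a /negP aL]; first exact: adj_near2.
  by move=> /inner_not_outer; apply; exact: notin_outer.
have reach z : ~ inner xi z ->
    exists2 w, outer xi w & chain (@near2 d) (~` inner xi) z w.
  pose v : site d := vec (Ordinal d0, false).
  have [m] : exists m, outer xi (z + v *+ m).
    have [n _ /(_ n (leqnn n)) nL] := sub_box_near L.
    exists (n + `|z ord0 (Ordinal d0)| + 1)%N; apply: notin_outer.
    apply: contra (fsubsetP nL _) _; apply: (@box_notin _ _ _ (Ordinal d0)).
    rewrite mxE mulmxnE vecE eqxx /= expr0 mulr1.
    by rewrite natz; move: (z ord0 (Ordinal d0)) => t; lia.
  elim: m z => [|m IH] z; first by rewrite mulr0n addr0; exists z => //; exact: chain_refl.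
  rewrite mulrS addrA => om iz; have [oz|oz] := pselect (outer xi z).
    by exists z => //; exact: chain_refl.
  have az : adj z (z + v) by apply/adj_vecP; exists (Ordinal d0, false).
  have izv : ~ inner xi (z + v) by move=> i; apply/iz/(inner_adj i); rewrite // adjC.
  have [w ow cw] := IH _ om izv; exists w => //.
  by apply: chain_trans cw; apply: chain1 => //; exact: adj_near2.
move=> /reach[u ou cu] /reach[w ow cw]; apply: chain_trans cu _.
by apply: (chain_trans (outer_conn _ _ ou ow)); exact: (chain_sym (@near2_sym d) cw).
Qed.

End properties.

Lemma erase_out xi x : (forall x, x \notin L -> xi x = plus) ->
  x \notin L -> erase xi x = plus.
Proof.
move=> Lxi xL; have ix : ~ inner xi x by move=> /inner_in; apply/negP.
by rewrite /erase (asboolF ix) asboolF ?Lxi// => /contour_inner.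
Qed.

(** The inner set is the part of the lattice reached from the origin without
    crossing an edge from a contour site to one of its neighbours that are not
    inner, so the data on the contour determine it. There [erase] is undone by a
    second flip. *)
Lemma erase_inj xi xi' :
  (forall x, x \notin L -> xi x = plus) -> (forall x, x \notin L -> xi' x = plus) ->
  xi 0 != plus -> xi' 0 != plus -> contour xi = contour xi' ->
  (forall x, contour xi x -> xi x = xi' x) ->
  (forall x a, contour xi x -> inner xi (x + vec a) <-> inner xi' (x + vec a)) ->
  erase xi = erase xi' -> xi = xi'.
Proof.
move=> Lxi Lxi' xi0 xi'0 cE sE mE eE.
have sub (z z' : config d) : (forall x, x \notin L -> z x = plus) ->
    (forall x, x \notin L -> z' x = plus) ->
    z 0 != plus -> z' 0 != plus -> contour z = contour z' ->
    (forall x a, contour z x -> inner z (x + vec a) <-> inner z' (x + vec a)) ->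
    inner z `<=` inner z'.
  move=> Lz Lz' z0 z'0 zE zm x ix.
  elim: (inner_connected (inner0 Lz z0) ix) => [|u v [iu iv uv] _ iu'].
    exact: inner0.
  apply: contrapT => iv'; have cu : contour z' u by split=> //; exists v.
  rewrite -zE in cu; move/adj_vecP: uv iv iv' => [a ->] iv iv'.
  by apply: iv'; apply/(zm u a cu).
have iE : inner xi = inner xi'.
  apply/seteqP; split; first exact: sub.
  by apply: sub => // x a; rewrite -cE => cx; split=> /(mE x a cx).
apply/funext => x; have := congr1 (fun f => f x) eE; rewrite /erase -cE -iE.
case: asboolP => [cx _|ncx]; first exact: sE.
by case: asboolP => // _; exact: (inv_inj flipK).
Qed.

End contour.

(** * Energy gain *)

Section energy.
Variables (R : realType) (d : nat) (L : {fset site d}).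

Definition contour_fset (xi : config d) : {fset site d} :=
  [fset x in L | `[< contour L xi x >]]%fset.

Lemma contour_fsetP xi x : reflect (contour L xi x) (x \in contour_fset xi).
Proof.
rewrite !inE /=; apply: (iffP andP) => [[_ /asboolP]//|cx].
by split; [exact: (inner_in (contour_inner cx))|exact/asboolP].
Qed.

Definition conflict (xi : config d) (e : {fset site d}) : R :=
  (\prod_(i <- e) spin_val (xi i) == -1)%:R.

Lemma adj_neq (i j : site d) : adj i j -> i != j.
Proof.
apply: contraTneq => ->; rewrite /adj subrr /norm1 big1// => k _.
by rewrite mxE normr0.
Qed.

(** The energy of a bond, which is encoded as a set with two elements. *)
Lemma conflictE xi i j : adj i j ->
  conflict xi [fset i; j]%fset = (spin_val (xi i) * spin_val (xi j) == -1)%:R.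
Proof.
move=> ij; rewrite /conflict big_fsetU1 ?big_seq_fset1//= inE.
exact: adj_neq.
Qed.

Variables (xi : config d) (Lxi : forall x, x \notin L -> xi x = plus).

Let C := contour_fset xi.

(* The conflict given up by a minus at the contour site [x]: the bond from [x] to a
   chosen neighbour that is not inner. Distinct sites give distinct bonds, as [x]
   is the only inner end of its bond. *)
Let hit (x : site d) (e : {fset site d}) : bool :=
  [&& x \in C, xi x == minus & e == [fset x; xget x [set y | adj x y /\ ~ inner L xi y]]%fset].

Let hitP x e : hit x e -> exists y, [/\ contour L xi x, xi x = minus, adj x y, ~ inner L xi y &
  e = [fset x; y]%fset].
Proof.
case/and3P => /contour_fsetP cx /eqP xm /eqP eE.
have [ix [y xy iy]] := cx.
have [axg ixg] := @xgetPex _ x _ (ex_intro (fun y => adj x y /\ ~ inner L xi y) y (conj xy iy)).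
by eexists; split; eauto.
Qed.

Let hits e : R := \sum_(x <- L) (hit x e)%:R.

Let hits_le e i : (forall x, hit x e -> x = i) -> hits e <= (hit i e)%:R.
Proof.
move=> H; rewrite /hits; have [iL|iL] := boolP (i \in L).
  rewrite (big_fsetD1 i)//= big1_seq ?addr0// => x /=.
  rewrite !inE => /andP[xi_ _]; case: (boolP (hit x e)) => // /H xE.
  by rewrite xE eqxx in xi_.
rewrite big1_seq // => x /= xL; case: (boolP (hit x e)) => // /H xE.
by rewrite -xE xL in iL.
Qed.

Let hits0 e : (forall x, ~~ hit x e) -> hits e = 0.
Proof. by move=> H; rewrite /hits big1// => x _; rewrite (negbTE (H x)). Qed.

Let eraseE x : erase L xi x =
  if `[< contour L xi x >] then plus
  else if `[< inner L xi x >] then flip (xi x) else xi x.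
Proof. by []. Qed.

(* A bond with an inner end either has both spins flipped or has an end on the contour.
   In the second case that end becomes plus, and its neighbour plus or zero. *)
Let erase_le1 i j : adj i j -> inner L xi i ->
  conflict (erase L xi) [fset i; j]%fset + hits [fset i; j]%fset <=
  conflict xi [fset i; j]%fset.
Proof.
move=> ij ii; rewrite !conflictE//.
have [Ij|nIj] := pselect (inner L xi j).
  rewrite hits0 ?addr0; last first.
    move=> x; apply/negP => /hitP[y [_ _ _ iy E]].
    have : y \in [fset i; j]%fset by rewrite E !inE eqxx orbT.
    by rewrite !inE => /orP[]/eqP yE; rewrite yE in iy.
  rewrite !eraseE (asboolT ii) (asboolT Ij).
  have [ci|ci] := asboolP (contour L xi i); have [cj|cj] := asboolP (contour L xi j).
  - by rewrite ler0n.
  - have := contour_near_not_plus Lxi ci (or_intror ij) Ij; rewrite spin_val_flip.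
    by case: (spinP (xi j)) => [->|_|_]; rewrite ?eqxx// ?oppr0 ?mulr0 ?ler0n// mul1r opprK ler0n.
  - have ji : adj j i by rewrite adjC.
    have := contour_near_not_plus Lxi cj (or_intror ji) ii; rewrite spin_val_flip.
    by case: (spinP (xi i)) => [->|_|_]; rewrite ?eqxx// ?oppr0 ?mul0r ?ler0n// mulr1 opprK ler0n.
  - by rewrite !spin_val_flip mulrNN.
have ci : contour L xi i by split=> //; exists j.
rewrite !eraseE (asboolT ci) (asboolF nIj) asboolF; last by move/contour_inner.
rewrite (outer_plus Lxi (adj_outer ii ij nIj)) add0r mulr1.
apply: (le_trans (@hits_le _ i _)) => [x /hitP[y [cx _ _ _ E]]|].
  have : x \in [fset i; j]%fset by rewrite E !inE eqxx.
  by rewrite !inE => /orP[]/eqP // xj; rewrite xj in cx; case: (nIj (contour_inner cx)).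
by case: (boolP (hit _ _)) => [/and3P[_ /eqP -> _]|]; rewrite ?ler0n.
Qed.

Let erase_le e : bedges L e -> conflict (erase L xi) e + hits e <= conflict xi e.
Proof.
move=> [i [j [-> ij _]]].
have [ii|nii] := pselect (inner L xi i); first exact: erase_le1.
have [Ij|nIj] := pselect (inner L xi j).
  by rewrite fsetUC; apply: erase_le1; rewrite // adjC.
rewrite !conflictE// !eraseE (asboolF nii) (asboolF nIj).
rewrite !asboolF; try by move/contour_inner.
rewrite hits0 ?addr0// => x; apply/negP => /hitP[y [cx _ _ _ E]].
have : x \in [fset i; j]%fset by rewrite E !inE eqxx.
by rewrite !inE => /orP[]/eqP xE; have := contour_inner cx; rewrite xE.
Qed.

Let bond_gain :
  \sum_(e \in bedges L) conflict (erase L xi) e +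
    \sum_(x <- L) ((x \in C) && (xi x == minus))%:R <=
  \sum_(e \in bedges L) conflict xi e.
Proof.
rewrite !(fsbig_finite _ _ (finite_bedges L)) /=.
apply: (@le_trans _ _ (\sum_(e <- fset_set (bedges L)) (conflict (erase L xi) e + hits e))).
  rewrite big_split /= lerD2l /hits exchange_big /=.
  apply: ler_sum => x _; case: (boolP (_ && _)) => [/andP[xC xm]|]; last first.
    by move=> _; apply: sumr_ge0.
  set e := [fset x; xget x [set y | adj x y /\ ~ inner L xi y]]%fset.
  have hx : hit x e by rewrite /hit xC xm eqxx.
  have eB : e \in fset_set (bedges L).
    rewrite in_fset_set; last exact: finite_bedges.
    apply/mem_set; have [y [cx _ xy _ ->]] := hitP hx.
    exists x, y; split=> //; apply/fset0Pn; exists x.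
    by rewrite !inE eqxx /=; exact: (inner_in (contour_inner cx)).
  by rewrite (big_fsetD1 e)//= hx lerDl sumr_ge0.
rewrite big_seq [X in _ <= X]big_seq; apply: ler_sum => e.
rewrite in_fset_set; last exact: finite_bedges.
by move=> /set_mem; exact: erase_le.
Qed.

(** With K = [expR kappa], every contour site improves the weight by a factor at
    least K: through the bonds if its spin was minus, through its own term if it
    was zero. *)
Lemma erase_gain (beta lambda kappa : R) :
  0 <= kappa -> kappa <= beta -> kappa <= ln lambda ->
  wr_exponent beta lambda 0 L xi + kappa *+ #|` C| <=
  wr_exponent beta lambda 0 L (erase L xi).
Proof.
move=> k0 kb kl; rewrite /wr_exponent.
have -> : kappa *+ #|` C| =
    kappa * \sum_(x <- L) ((x \in C) && (xi x == minus))%:R +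
    \sum_(x <- L) kappa * ((x \in C) && (xi x != minus))%:R.
  rewrite -mulr_sumr -mulrDr -big_split /= -mulr_natr; congr (_ * _).
  rewrite -sum1_size natr_sum.
  rewrite [in RHS](eq_bigr (fun x => if x \in C then 1 else 0 : R)); last first.
    by move=> x _; case: (x \in C); case: (xi x == minus); rewrite /= ?addr0 ?add0r.
  rewrite -big_mkcond /=; apply: eq_fbigl_cond => x; rewrite !inE andbT.
  by apply/idP/andP => [xC|[]//]; split=> //; case/andP: xC.
rewrite addrACA; apply: lerD.
  rewrite -subr_ge0 (_ : _ - _ = beta * (\sum_(e \in bedges L) conflict xi e) -
    beta * (\sum_(e \in bedges L) conflict (erase L xi) e) -
    kappa * \sum_(x <- L) ((x \in C) && (xi x == minus))%:R); last by rewrite /conflict; ring.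
  rewrite -mulrBr subr_ge0; apply: (@le_trans _ _
    (beta * \sum_(x <- L) ((x \in C) && (xi x == minus))%:R)).
    by rewrite ler_wpM2r// sumr_ge0.
  by rewrite ler_wpM2l ?(le_trans k0)// lerBrDl; exact: bond_gain.
rewrite -big_split /=; apply: ler_sum => x _; rewrite !mul0r !addr0 eraseE.
case: (boolP (x \in C)) => [xC|/contour_fsetP xC].
  move: (xC) => /contour_fsetP cx; rewrite (asboolT cx) rmorph1 expr1n mulr1 /=.
  have := contour_near_not_plus Lxi cx (or_introl erefl) (contour_inner cx).
  case: (spinP (xi x)) => [->|x0|->]; rewrite ?eqxx// => _.
    by rewrite expr0n mulr0 add0r (le_trans _ kl)// ler_piMr// lern1 leq_b1.
  by rewrite rmorphN1 sqrrN expr1n mulr1 mulr0 addr0.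
rewrite (asboolF xC) mulr0 addr0; case: ifP => // _.
by rewrite spin_val_flip rmorphN sqrrN.
Qed.

End energy.

(** * Counting contours *)

(** The Peierls estimate in abstract form: among the states with a given code [T] is
    injective, so that their total weight is at most [r m] times the total weight of
    all states. *)
Lemma sum_by_codes (R : numDomainType) (X : finType) (W : X -> R) (T : X -> X)
    (bad : pred X) (N : nat) (Code : nat -> finType)
    (codes : forall m, X -> Code m -> Prop) (r : nat -> R) :
  (forall x, 0 <= W x) -> (forall m, 0 <= r m) ->
  (forall x, bad x -> exists m (c : Code m), (m < N)%N /\ codes m x c) ->
  (forall x y m c, bad x -> bad y -> codes m x c -> codes m y c -> T x = T y -> x = y) ->
  (forall x m c, bad x -> codes m x c -> W x <= r m * W (T x)) ->
  \sum_(x | bad x) W x <= (\sum_(m < N) r m * #|Code m|%:R) * \sum_x W x.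
Proof.
move=> W0 r0 cex cinj cW.
pose S m c := [pred x | bad x && `[< codes m x c >]].
apply: (@le_trans _ _ (\sum_(m < N) \sum_(c : Code m) \sum_(x | S m c x) W x)).
  under [X in _ <= X]eq_bigr do under eq_bigr do rewrite big_mkcondr.
  under [X in _ <= X]eq_bigr do rewrite exchange_big.
  rewrite exchange_big /=; apply: ler_sum => x bx.
  have [m [c [mN cx]]] := cex x bx.
  have t0 i c' : 0 <= (if `[< codes i x c' >] then W x else 0) by case: ifP.
  rewrite (bigD1 (Ordinal mN))//= (bigD1 c)//= (asboolT cx) -addrA lerDl.
  by rewrite addr_ge0// sumr_ge0// => i _; rewrite sumr_ge0.
rewrite mulr_suml; apply: ler_sum => m _.
rewrite -mulrA mulr_natl -sumr_const mulr_sumr; apply: ler_sum => c _.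
apply: (@le_trans _ _ (\sum_(x | S m c x) r m * W (T x))).
  by apply: ler_sum => x /andP[bx /asboolP cx]; exact: cW cx.
rewrite -mulr_sumr ler_wpM2l//.
rewrite -(big_imset (h := T) (A := S m c) W) /=.
  by rewrite [X in _ <= X](bigID [in T @: S m c]) /= lerDl sumr_ge0.
move=> x y /andP[bx /asboolP cx] /andP[by_ /asboolP cy]; exact: cinj cx cy.
Qed.

Section peierls.
Variables (R : realType) (d : nat) (d2 : (2 <= d)%N).

(** What a contour site has to record for [erase_inj]: its spin, and which of its
    neighbours are inner. *)
Definition mark : Type := (spin * {ffun dir d -> bool})%type.
HB.instance Definition _ := Finite.on mark.

Definition mark_of (L : {fset site d}) (xi : config d) (x : site d) : mark :=
  (xi x, [ffun a => `[< inner L xi (x + vec a) >]]).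

(** For a contour of [m.+1] sites: the distance to the origin of a contour site on
    a half-axis, the [m.*2] steps of a closed walk from there which covers the
    contour, and the marks read along the walk. *)
Definition contour_code (m : nat) : finType :=
  ('I_(4 * m.+1) * (m.*2).-tuple (step d) * (m.*2.+1).-tuple mark)%type.

Let axis (b : bool) : dir d := (Ordinal (ltnW d2), b).

Let walk m (c : contour_code m) : seq (site d) :=
  let b := vec (axis false) *+ c.1.1 in b :: scanl (@shift_by d) b c.1.2.

Let codes L m (xi : config d) (c : contour_code m) : Prop :=
  [/\ walk c =i contour_fset L xi, #|` contour_fset L xi| = m.+1 &
      c.2 = map (mark_of L xi) (walk c) :> seq mark].

Let codes_inj L m xi xi' (c : contour_code m) :
  (forall x, x \notin L -> xi x = plus) -> (forall x, x \notin L -> xi' x = plus) ->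
  xi 0 != plus -> xi' 0 != plus -> codes L xi c -> codes L xi' c ->
  erase L xi = erase L xi' -> xi = xi'.
Proof.
move=> Lxi Lxi' xi0 xi'0 [wE _ mE] [wE' _ mE'] eE.
have mark_eq x : contour L xi x -> mark_of L xi x = mark_of L xi' x.
  have /eq_in_map H : map (mark_of L xi) (walk c) = map (mark_of L xi') (walk c).
    by rewrite -mE.
  by move=> /contour_fsetP; rewrite -wE => /H.
apply: (@erase_inj _ L) => //.
- apply/seteqP; split=> x /contour_fsetP.
    by rewrite -wE wE' => /contour_fsetP.
  by rewrite -wE' wE => /contour_fsetP.
- by move=> x /mark_eq[].
- move=> x a /mark_eq[_ /ffunP/(_ a)]; rewrite !ffunE => E.
  by split=> /asboolP; [rewrite E|rewrite -E] => /asboolP.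
Qed.

(* The walk starts where the positive half-axis leaves the inner set. It also visits
   the point where the negative half-axis does, and each of its [m.*2] steps changes a
   coordinate by at most two; this bounds the distance to the origin by [4 * m]. *)
Let codes_ex n (L := box d n) xi :
  (forall x, x \notin L -> xi x = plus) -> xi 0 != plus ->
  exists m (c : contour_code m), (m < #|` L|)%N /\ codes L xi c.
Proof.
move=> Lxi xi0.
have exit b : exists k, contour L xi (vec (axis b) *+ k).
  have [||k] := @ray_inner_bd d (inner L xi) (axis b) 0 n.+1.
  - exact: inner0.
  - move=> /inner_in; apply/negP/(@box_notin _ _ _ (Ordinal (ltnW d2))).
    rewrite add0r mulmxnE vecE eqxx mulr1 normrMn normrX normrN1 expr1n.
    by rewrite natz; lia.
  - by rewrite add0r => ck; exists k.
have [k ck] := exit false; have [l cl] := exit true.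
have extc x y : x \notin L -> y \notin L -> chain (fun u v => adj u v) (~` [set` L]) x y.
  exact: box_exterior_connected.
have Bconn x : x \in contour_fset L xi ->
    chain (@near2 d) [set` contour_fset L xi] (vec (axis false) *+ k) x.
  move=> /contour_fsetP cx.
  have sub : contour L xi `<=` [set` contour_fset L xi] by move=> ? /contour_fsetP.
  apply: (sub_chain _ sub) => [? ? _ _|]; first by apply.
  apply: inner_bd_connected => // u v.
    exact: inner_connected.
  by apply: inner_co_connected => //; exact: ltnW.
have /contour_fsetP ckB := ck.
have [s [ps sB szs]] := covering_walk (@near2_sym d) ckB Bconn.
case mE : #|` contour_fset L xi| => [|m] in szs; first by rewrite double0 in szs.
have {}szs : size s = m.*2 by move: szs; rewrite doubleS => -[].
have [t tsz sE] := walk_steps ps.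
have km : (k < 4 * m.+1)%N.
  have /contour_fsetP := cl; rewrite -sB => /(walk_dist (Ordinal (ltnW d2)) ps).
  rewrite !mulmxnE !vecE eqxx !mulr1 /= expr0 expr1 szs.
  rewrite mulNrn natz -[1 *+ k]/(k%:R) natz; lia.
rewrite -tsz in szs.
have tP : size t == m.*2 by apply/eqP.
have mP : size (map (mark_of L xi) (vec (axis false) *+ k :: s)) == m.*2.+1.
  by rewrite size_map /= -tsz szs.
exists m, (Ordinal km, Tuple tP, Tuple mP).
split; last by split=> //=; rewrite /walk /= -?sE.
rewrite -mE; apply/fsubset_leq_card/fsubsetP => x; rewrite !inE => /andP[//].
Qed.

Definition code_base : nat := #|{: step d}| * #|{: mark}|.

Lemma card_contour_code m :
  (#|contour_code m| * 4 ^ m.+1 <= (16 * code_base ^ 2) ^ m.+1)%N.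
Proof.
have s0 : (0 < #|{: step d}|)%N by apply/card_gt0P; exists (None, None).
have k0 : (0 < #|{: mark}|)%N by apply/card_gt0P; exists (plus, [ffun=> true]).
rewrite !card_prod !card_tuple card_ord /code_base.
set s := #|{: step d}| in s0 *; set k := #|{: mark}| in k0 *.
have -> : ((16 * (s * k) ^ 2) ^ m.+1 =
    4 ^ m.+1 * s ^ (m.+1).*2 * k ^ (m.+1).*2 * 4 ^ m.+1)%N.
  rewrite expnMn -expnM mul2n expnMn (_ : 16 = 4 * 4)%N// expnMn; ring.
rewrite leq_mul2r leq_mul ?orbT//; last by rewrite leq_pexp2l// doubleS.
rewrite leq_mul//; last by rewrite leq_pexp2l// doubleS ltnW.
by rewrite expnS leq_mul2l /= ltn_expl.
Qed.

Lemma geometric_quarter N : \sum_(m < N) (4^-1 : R) ^+ m.+1 <= 3^-1.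
Proof.
suff -> : \sum_(m < N) (4^-1 : R) ^+ m.+1 = 3^-1 - 3^-1 * 4^-1 ^+ N.
  by rewrite gerBl mulr_ge0 ?exprn_ge0// invr_ge0.
elim: N => [|N IH]; first by rewrite big_ord0 expr0 mulr1 subrr.
by rewrite big_ord_recr /= IH exprS; field.
Qed.

(** By [card_contour_code] the contours of size n have total weight at most
    [4 ^- n] once every contour site costs this factor. *)
Definition peierls_constant : R := (16 * code_base ^ 2)%:R.

Lemma peierls_constant_gt1 : 1 < peierls_constant.
Proof.
rewrite /peierls_constant ltr1n.
have s0 : (0 < #|{: step d}|)%N by apply/card_gt0P; exists (None, None).
have k0 : (0 < #|{: mark}|)%N by apply/card_gt0P; exists (plus, [ffun=> true]).
have b0 : (0 < code_base ^ 2)%N by rewrite expn_gt0 muln_gt0 s0 k0.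
exact: (@leq_mul 2 1 16).
Qed.

(** Erasing the contour gains K per site, while the number of codes is at most
    [(K / 4) ^+ n], so the sum over the sizes of the contour is a geometric series. *)
Lemma peierls_bound (beta lambda : R) n :
  ln peierls_constant <= beta -> peierls_constant <= lambda ->
  \sum_(w : {ffun box d n -> spin} | paste w (fun=> plus) 0 != plus)
    wr_prob beta lambda 0 w (fun=> plus) <= 3^-1.
Proof.
set K := peierls_constant => Kb Kl.
have K1 : 1 < K := peierls_constant_gt1.
have K0 : 0 < K by exact: lt_trans K1.
set L := box d n; set eta : config d := fun=> plus.
pose ext (w : {ffun L -> spin}) : config d := paste w eta.
have extL w x : x \notin L -> ext w x = plus by move=> xL; rewrite /ext paste_notin.
pose T (w : {ffun L -> spin}) : {ffun L -> spin} := [ffun i => erase L (ext w) (val i)].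
have extT w : ext (T w) = erase L (ext w).
  apply/funext => x; have [xL|xL] := boolP (x \in L).
    by rewrite /ext (paste_in _ _ xL) ffunE.
  by rewrite extL// erase_out//; exact: extL.
have ext_inj w w' : ext w = ext w' -> w = w'.
  move=> E; apply/ffunP => -[i iL]; have := congr1 (fun f => f i) E.
  by rewrite /ext !(paste_in _ _ iL).
rewrite -mulr_suml ler_pdivrMr ?wr_Z_gt0//.
apply: le_trans (ler_wpM2r (ltW (wr_Z_gt0 _ _ _ _ _)) (geometric_quarter #|` L|)).
apply: (le_trans (@sum_by_codes _ _ (fun w => wr_weight beta lambda 0 w eta) T
  (fun w => paste w eta 0 != plus) #|` L| contour_code (fun m w c => codes L (ext w) c)
  (fun m => K ^- m.+1) _ _ _ _ _)).
- by move=> w; exact/ltW/wr_weight_gt0.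
- by move=> m; rewrite invr_ge0 exprn_ge0 ?ltW.
- by move=> w w0; apply: codes_ex => //; exact: extL.
- move=> w w' m c w0 w'0 cw cw' TE; apply: ext_inj.
  apply: (codes_inj _ _ w0 w'0 cw cw'); [exact: extL|exact: extL|].
  by rewrite -!extT TE.
- move=> w m c w0 [_ szc _].
  rewrite ler_pdivlMl ?exprn_gt0// /wr_weight -/(ext w) -/(ext (T w)) extT.
  have -> : K ^+ m.+1 = expR (ln K *+ m.+1) by rewrite -mulr_natr expRM_natr lnK.
  rewrite -expRD ler_expR addrC -szc; apply: erase_gain => //.
  - exact: extL.
  - by rewrite ln_ge0 ?ltW.
  - by rewrite ler_ln ?posrE// (lt_le_trans K0).
rewrite ler_wpM2r ?(ltW (wr_Z_gt0 _ _ _ _ _))//; apply: ler_sum => m _.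
rewrite exprVn ler_pdivrMl ?exprn_gt0// ler_pdivlMr ?exprn_gt0//.
by rewrite -!natrX -natrM ler_nat card_contour_code.
Qed.

End peierls.

(** * Cylinder sets *)

Definition agree d (M : {fset site d}) (x y : config d) : Prop :=
  forall i, i \in M -> x i = y i.

Definition cylinder d (A : set (config d)) : Prop :=
  exists M : {fset site d}, forall x y, agree M x y -> A x -> A y.

Definition restr d (M : {fset site d}) (x : config d) : {ffun M -> spin} :=
  [ffun i => x (val i)].

Lemma agree_sym d (M : {fset site d}) x y : agree M x y -> agree M y x.
Proof. by move=> xy i iM; rewrite xy. Qed.

Lemma restr_agree d (M : {fset site d}) x y : restr M x = restr M y <-> agree M x y.
Proof.
split=> [/ffunP E i iM|E]; first by have := E [` iM]%fset; rewrite !ffunE.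
by apply/ffunP => i; rewrite !ffunE E// fsvalP.
Qed.

Lemma restr_paste d (M : {fset site d}) (v : {ffun M -> spin}) z :
  restr M (paste v z) = v.
Proof. by apply/ffunP => -[i iM]; rewrite ffunE /= (paste_in _ _ iM). Qed.

Lemma cylinder_fiber d (M : {fset site d}) (v : {ffun M -> spin}) :
  cylinder (restr M @^-1` [set v]).
Proof. by exists M => x y /restr_agree /= ->. Qed.

Lemma cylinder0 d : cylinder (set0 : set (config d)). Proof. by exists fset0. Qed.

Lemma cylinderC d (A : set (config d)) : cylinder A -> cylinder (~` A).
Proof.
by move=> [M AM]; exists M => x y xy nAx Ay; apply/nAx/(AM y x) => //; exact: agree_sym.
Qed.

Lemma cylinderU d (A B : set (config d)) : cylinder A -> cylinder B -> cylinder (A `|` B).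
Proof.
move=> [M AM] [N BN]; exists (M `|` N)%fset => x y xy [Ax|Bx]; [left|right].
  by apply: (AM x y _ Ax) => i iM; apply: xy; rewrite inE iM.
by apply: (BN x y _ Bx) => i iM; apply: xy; rewrite inE iM orbT.
Qed.

Lemma cylinderI d (A B : set (config d)) : cylinder A -> cylinder B -> cylinder (A `&` B).
Proof.
by move=> cA cB; rewrite -[_ `&` _]setCK setCI; apply/cylinderC/cylinderU; exact: cylinderC.
Qed.

Lemma cylinder_coord d (i : site d) (a : set spin) : cylinder [set w : config d | a (w i)].
Proof. by exists [fset i]%fset => x y xy /=; rewrite (xy i)// inE. Qed.

Lemma measurable_fiber d (M : {fset site d}) (v : {ffun M -> spin}) :
  measurable (restr M @^-1` [set v] : set (confT d)).
Proof.
rewrite (_ : _ @^-1` _ = \bigcap_(i in [set: M]) [set w : confT d | w (val i) = v i]).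
  by apply: fin_bigcap_measurable => // i _; exact: (@coord_measurable _ _ _ [set v i]).
apply/seteqP; split=> [x /= <- i _|x xv /=]; first by rewrite ffunE.
by apply/ffunP => i; rewrite ffunE; exact: xv.
Qed.

Lemma cylinder_fibers d (A : set (config d)) : cylinder A ->
  exists (M : {fset site d}) (S : set {ffun M -> spin}), A = \bigcup_(v in S) (restr M @^-1` [set v]).
Proof.
move=> [M AM]; exists M, (restr M @` A); apply/seteqP; split=> x.
  by move=> Ax; exists (restr M x) => //; exists x.
by move=> [_ [y Ay <-] /= /restr_agree xy]; apply: (AM y x) => //; exact: agree_sym.
Qed.

Lemma cylinder_measurable d (A : set (config d)) :
  cylinder A -> measurable (A : set (confT d)).
Proof.
move=> /cylinder_fibers[M [S ->]]; apply: fin_bigcup_measurable => //.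
by move=> v _; exact: measurable_fiber.
Qed.

(** The configurations with the algebra of cylinder sets in place of the product
    sigma-algebra. *)
Definition cylT d : Type := config d.
HB.instance Definition _ d := Pointed.on (cylT d).
HB.instance Definition _ d := @isAlgebraOfSets.Build default_measure_display (cylT d)
  (@cylinder d) (@cylinder0 d) (@cylinderU d) (@cylinderC d).

(** * Limits of probability measures along an ultrafilter *)

Lemma fmap_ultra T T' (f : T -> T') (F : set_system T) : UltraFilter F -> UltraFilter (f @ F).
Proof.
move=> FU; split=> [|G GP FG]; first exact: fmap_proper_filter.
apply/seteqP; split=> // B GB; have [//|nB] := in_ultra_setVsetC (f @^-1` B) FU.
have /filter_ex[y []] // : G (B `&` ~` B) by apply: filterI GB _; exact: FG.
Qed.

Section limit.
Variables (R : realType) (d : nat) (P : nat -> {measure set (confT d) -> \bar R}).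
Hypothesis P1 : forall n, P n setT = 1%E.
Variables (U : set_system nat) (UU : UltraFilter U) (Uoo : \oo `<=` U).

Let UF : ProperFilter U := ultra_proper.

(** Compactness of the configuration space: along an ultrafilter every coordinate is
    eventually constant, since there are finitely many spins. *)
Lemma config_limit (x : nat -> config d) :
  exists y, forall M : {fset site d}, U [set n | agree M (x n) y].
Proof.
have lim1 i : exists s, U [set n | x n i = s].
  have [Up|Up] := in_ultra_setVsetC [set n | x n i = plus] UU; first by exists plus.
  have [Um|Um] := in_ultra_setVsetC [set n | x n i = minus] UU; first by exists minus.
  exists point; apply: filterS (filterI Up Um) => n /= [np nm].
  by apply: spin_val_inj; case: (spinP (x n i)).
have [y yP] := choice lim1; exists y => M.
have := @filter_bigI _ _ M (fun i => [set n | x n i = y i]) U UF (fun i _ => yP i).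
apply: filterS => n /= H i iM; exact: H.
Qed.

(** A cylinder set is compact and the [F n] are open, so finitely many of them cover
    the union; as they are disjoint, the others are empty. This turns finite
    additivity on cylinder sets into countable additivity. *)
Lemma cylinder_finite_cover (F : nat -> set (config d)) :
  (forall n, cylinder (F n)) -> trivIset setT F -> cylinder (\bigcup_n F n) ->
  exists N, forall n, (N <= n)%N -> F n = set0.
Proof.
move=> cF tF [M UM]; apply: contrapT => nN.
have ex N : exists x, (\bigcup_n F n) x /\ forall n, (n < N)%N -> ~ F n x.
  apply: contrapT => nx; apply: nN; exists N => n Nn; apply/seteqP; split=> // x Fx.
  apply: nx; exists x; split=> [|k kN Fk]; first by exists n.
  have nk : n != k by rewrite gtn_eqF// (leq_trans kN).
  by move/trivIsetP : tF => /(_ n k I I nk) /seteqP[+ _] => /(_ x); apply.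
have [x xP] := choice ex; have [y yP] := config_limit x.
have [n /= ny] := filter_ex (yP M).
have [m _ Fmy] := UM _ _ ny (xP n).1.
have [M' FM'] := cF m.
have Um : U [set k | (m < k)%N] by apply: Uoo; exists m.+1.
have [k [ky mk]] := filter_ex (filterI (yP M') Um).
by apply: ((xP k).2 m mk); apply: (FM' y) => //; exact: agree_sym.
Qed.

Let p (A : set (config d)) n : R := fine (P n A).

Let fin A n : measurable (A : set (confT d)) -> P n A \is a fin_num.
Proof.
move=> mA; rewrite ge0_fin_numE ?measure_ge0// (@le_lt_trans _ _ 1%E) ?ltry//.
by rewrite -(P1 n) le_measure// ?inE.
Qed.

Let p01 A n : measurable (A : set (confT d)) -> p A n \in `[0, 1].
Proof.
move=> mA; rewrite in_itv /= fine_ge0 ?measure_ge0//= -lee_fin fineK ?fin//.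
by rewrite -(P1 n) le_measure// ?inE.
Qed.

Let p_cvg A : measurable (A : set (confT d)) -> cvg (p A @ U).
Proof.
move=> mA; have := @segment_compact R 0 1; rewrite compact_ultra => /(_ (p A @ U)).
case.
- exact: fmap_ultra.
- by rewrite nbhs_simpl /=; apply: filterE => n; exact: p01.
- by move=> l [_ pl]; apply/cvg_ex; exists l.
Qed.

Let l (A : set (config d)) : R := lim (p A @ U).

Let p_l A : measurable (A : set (confT d)) -> p A @ U --> l A.
Proof. exact: p_cvg. Qed.

Let l_ge0 A : measurable (A : set (confT d)) -> 0 <= l A.
Proof.
move=> mA; apply: limr_ge; first exact: p_cvg.
by apply: filterE => n; have := p01 n mA; rewrite in_itv => /andP[].
Qed.

Let l_set0 : l set0 = 0.
Proof.
have -> : l set0 = lim ((fun=> 0 : R) @ U).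
  by congr (lim (_ @ U)); apply/funext => n; rewrite /p measure0.
exact: lim_cst.
Qed.

Let l_setT : l setT = 1.
Proof.
have -> : l setT = lim ((fun=> 1 : R) @ U).
  by congr (lim (_ @ U)); apply/funext => n; rewrite /p P1.
exact: lim_cst.
Qed.

Let l_add A B : measurable (A : set (confT d)) -> measurable (B : set (confT d)) ->
  A `&` B = set0 -> l (A `|` B) = l A + l B.
Proof.
move=> mA mB AB; apply: cvg_lim => //.
rewrite (_ : p (A `|` B) = p A \+ p B); first by apply: cvgD; exact: p_l.
by apply/funext => n; rewrite /p measureU// fineD ?fin.
Qed.

(** The absolute value only serves to make the function nonnegative on all sets;
    on cylinder sets the limit is nonnegative anyway. *)
Definition limit_content (A : set (cylT d)) : \bar R := `|l A|%:E.

Let limit_contentE (A : set (cylT d)) : cylinder A -> limit_content A = (l A)%:E.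
Proof. by move=> cA; rewrite /limit_content ger0_norm// l_ge0//; exact: cylinder_measurable. Qed.

Let limit_content0 : limit_content set0 = 0%E.
Proof. by rewrite /limit_content l_set0 normr0. Qed.

Let limit_content_ge0 A : (0 <= limit_content A)%E.
Proof. by rewrite lee_fin. Qed.

Let limit_content_sigma_additive : semi_sigma_additive limit_content.
Proof.
move=> F mF tF mUF.
have cF n : cylinder (F n) := mF n.
have [N FN] := cylinder_finite_cover cF tF mUF.
have addn n : cylinder (\big[setU/set0]_(i < n) F i) /\
    (\sum_(0 <= i < n) limit_content (F i))%E = limit_content (\big[setU/set0]_(i < n) F i).
  elim: n => [|n [cn IH]]; first by rewrite !big_ord0 big_nil limit_content0; split=> //; exact: cylinder0.
  rewrite big_nat_recr //= IH big_ord_recr /=; split; first by apply: cylinderU.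
  rewrite !limit_contentE//; last by apply: cylinderU.
  rewrite -EFinD l_add//; [exact: cylinder_measurable|exact: cylinder_measurable|].
  rewrite -bigcup_mkord setI_bigcupl; apply: bigcup0 => i /= in_.
  by move/trivIsetP : tF; apply => //; rewrite ltn_eqF.
apply: cvg_near_cst; exists N => // n /= Nn.
rewrite (addn n).2; congr limit_content; rewrite -bigcup_mkord.
apply/seteqP; split=> x; first by move=> [i _ Fi]; exists i.
move=> [i _ Fi]; exists i => //=; rewrite ltnNge; apply/negP => ni.
by move: Fi; rewrite FN// (leq_trans Nn).
Qed.

HB.instance Definition _ := isMeasure.Build _ (cylT d) R limit_content
  limit_content0 limit_content_ge0 limit_content_sigma_additive.

Let cylS : measurableType _ := g_sigma_algebraType (@measurable _ (cylT d)).

Let cylS_measurable (A : set (config d)) :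
  measurable (A : set (confT d)) -> measurable (A : set cylS).
Proof.
apply: smallest_sub; first exact: smallest_sigma_algebra.
move=> _ [i _ [a _ <-]]; rewrite setTI; apply: sub_sigma_algebra.
exact: cylinder_coord.
Qed.

Definition limit_measure (A : set (confT d)) : \bar R :=
  measure_extension limit_content (A : set cylS).

Let limit_measureE (A : set (config d)) : cylinder A -> limit_measure A = (l A)%:E.
Proof. by move=> cA; rewrite -limit_contentE//; exact: measurable_mu_extE. Qed.

Let limit_measure0 : limit_measure set0 = 0%E. Proof. exact: measure0. Qed.

Let limit_measure_ge0 A : (0 <= limit_measure A)%E. Proof. exact: measure_ge0. Qed.

Let limit_measure_sigma_additive : semi_sigma_additive limit_measure.
Proof.
move=> F mF tF mUF; apply: (measure_semi_sigma_additive (F : nat -> set cylS)) => //.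
  by move=> n; exact: cylS_measurable (mF n).
exact: cylS_measurable.
Qed.

HB.instance Definition _ := isMeasure.Build _ (confT d) R limit_measure
  limit_measure0 limit_measure_ge0 limit_measure_sigma_additive.

Let limit_measureT : limit_measure setT = 1%E.
Proof.
rewrite limit_measureE ?l_setT// -setC0; apply: cylinderC; exact: cylinder0.
Qed.

HB.instance Definition _ := Measure_isProbability.Build _ _ _ limit_measure limit_measureT.

(** The space of probability measures on configurations is compact for the
    convergence on cylinder sets: the limits form a finitely additive content on
    the algebra of cylinder sets, extended by Caratheodory. *)
Lemma cylinder_limit_measure : exists mu : probability (confT d) R,
  forall A, cylinder A -> (fun n => fine (P n A)) @ U --> fine (mu A).
Proof.
exists limit_measure => A cA; rewrite /= limit_measureE//=.
by apply: p_l; exact: cylinder_measurable.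
Qed.

End limit.

(** * Gibbs measures from the DLR equations *)

Lemma coord_sets_measurable d (I : set (site d)) (B : set (config d)) :
  measurable (B : set (coordT I)) -> measurable (B : set (confT d)).
Proof.
apply: smallest_sub; first exact: smallest_sigma_algebra.
by move=> _ [i _ [a _ <-]]; rewrite setTI; exact: (@coord_measurable d setT).
Qed.

Section dlr.
Variables (R : realType) (d : nat) (g : specification R d) (mu : probability (confT d) R).

Lemma spec_measurable L (A : set (confT d)) : measurable A ->
  measurable_fun [set: confT d] ((fun x => g L x A) : confT d -> \bar R).
Proof.
move=> mA _ Y mY; rewrite setTI; apply: (@coord_sets_measurable _ (~` [set` L])).
by have := measurable_kernel (g L) A mA measurableT Y mY; rewrite setTI.
Qed.

(** Properness: the boundary condition is kept, so [g L x] gives full measure to the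
    events of the exterior that hold at [x] and none to the others. *)
Lemma spec_restrict L (A B : set (config d)) x :
  measurable (A : set (confT d)) -> measurable (B : set (coordT (~` [set` L]))) ->
  g L x (A `&` B) = ((fun x => g L x A) \_ B) x.
Proof.
move=> mA mB; have mB' := coord_sets_measurable mB.
have null (C D : set (confT d)) : measurable C -> measurable D -> C `<=` D ->
    g L x D = 0%E -> g L x C = 0%E.
  by move=> mC mD; exact: (@subset_measure0 _ _ _ (g L x)).
rewrite patchE; case: ifPn => xB.
  rewrite [RHS](measureDI (g L x) mA mB') [X in (X + _)%E](_ : _ = 0%E) ?add0e//.
  apply: (null _ (~` B)); [exact: measurableD|exact: measurableC| |].
    by rewrite setDE; exact: subIsetr.
  rewrite spec_proper; last exact: measurableC.
  by rewrite indicE in_setC xB.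
apply: (null _ B) => //; first exact: measurableI.
by rewrite spec_proper// indicE (negbTE xB).
Qed.

(** By [spec_restrict], restricting the conditioning to an exterior event [B] amounts
    to replacing [A] by [A `&` B], so the conditional probabilities are already
    characterized by the DLR equations without conditioning event. *)
Lemma dlr_admitted :
  (forall L (A : set (confT d)), measurable A -> (\int[mu]_x g L x A = mu A)%E) ->
  admitted g mu.
Proof.
move=> dlr L A mA; exists (fun w => g L w A); last exact: aeW.
split.
- exact: measurable_kernel.
- apply/integrableP; split; first exact: spec_measurable.
  under eq_integral do rewrite gee0_abs//.
  by rewrite dlr// -ge0_fin_numE// fin_num_measure.
- move=> B mB; have mB' := coord_sets_measurable mB.
  rewrite -(dlr L (A `&` B)); last exact: measurableI.
  rewrite integral_mkcond; apply: eq_integral => x _.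
  by rewrite spec_restrict.
Qed.

Section average.
Variable L : {fset site d}.

Definition average (A : set (confT d)) : \bar R := (\int[mu]_x g L x A)%E.

Let average0 : average set0 = 0%E.
Proof. by rewrite /average; under eq_integral do rewrite measure0; exact: integral0. Qed.

Let average_ge0 A : (0 <= average A)%E.
Proof. by apply: integral_ge0. Qed.

Let average_sigma_additive : semi_sigma_additive average.
Proof.
move=> F mF tF mUF; rewrite /average.
have -> : (\int[mu]_x g L x (\bigcup_n F n))%E = (\sum_(n <oo) \int[mu]_x g L x (F n))%E.
  rewrite -integral_nneseries//; last by move=> n; exact: spec_measurable.
  by apply: eq_integral => x _; exact: measure_semi_bigcup.
by apply: is_cvg_ereal_nneg_natsum => n _; exact: integral_ge0.
Qed.

HB.instance Definition _ := isMeasure.Build _ (confT d) R average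
  average0 average_ge0 average_sigma_additive.

(** Two probability measures which agree on the cylinder sets are equal, as these are
    stable under intersection and generate the sigma-algebra. *)
Lemma average_cylinder : (forall A : set (confT d), cylinder A -> average A = mu A) ->
  forall A : set (confT d), measurable A -> average A = mu A.
Proof.
move=> cE; apply: (@measure_unique _ R (confT d) (@cylinder d) (fun=> setT)) => //.
- apply/seteqP; split=> A.
    apply: smallest_sub; first exact: smallest_sigma_algebra.
    move=> _ [i _ [a _ <-]]; rewrite setTI; apply: sub_sigma_algebra.
    exact: cylinder_coord.
  apply: smallest_sub; first exact: smallest_sigma_algebra.
  exact: cylinder_measurable.
- by move=> A B; exact: cylinderI.
- by move=> _; rewrite -setC0; apply: cylinderC; exact: cylinder0.
- by rewrite bigcup_const//; exists 0%N.
- move=> _; rewrite /= cE; last by rewrite -setC0; apply: cylinderC; exact: cylinder0.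
  by rewrite probability_setT ltry.
Qed.

End average.

Lemma dlr_cylinder_gibbs :
  (forall L (A : set (confT d)), cylinder A -> (\int[mu]_x g L x A = mu A)%E) ->
  gibbs g mu.
Proof.
by move=> dlr; apply: dlr_admitted => L A mA; apply: average_cylinder => // C; exact: dlr.
Qed.

End dlr.

(** A function of finitely many coordinates takes finitely many values, so its
    integral is a finite combination of probabilities of cylinder sets. The
    configuration [z] fills the irrelevant coordinates. *)
Lemma integral_cylinder (R : realType) d (Q : {measure set (confT d) -> \bar R})
    (phi : config d -> R) (M : {fset site d}) (z : config d) :
  (forall x, 0 <= phi x) -> (forall x y, agree M x y -> phi x = phi y) ->
  (\int[Q]_x (phi x)%:E =
   \sum_(v : {ffun M -> spin}) (phi (paste v z))%:E * Q (restr M @^-1` [set v]))%E.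
Proof.
move=> phi0 phiM.
have mF (v : {ffun M -> spin}) : measurable (restr M @^-1` [set v] : set (confT d)).
  exact: measurable_fiber.
rewrite (eq_integral (fun x => \sum_(v : {ffun M -> spin})
    (phi (paste v z))%:E * (\1_(restr M @^-1` [set v] : set (confT d)) x)%:E)%E); last first.
  move=> x _; rewrite (bigD1 (restr M x))//= big1 ?adde0.
    rewrite indicE mem_set// mule1; congr EFin; apply: phiM.
    by apply/restr_agree; rewrite restr_paste.
  by move=> v vx; rewrite indicE memNset ?mule0//= => xv; rewrite xv eqxx in vx.
rewrite ge0_integral_sum//.
- apply: eq_bigr => v _; rewrite ge0_integralZl_EFin//.
    by rewrite integral_indic// setIT.
  by apply/measurable_EFinP; exact: measurable_indic.
- move=> v; apply: measurable_funeM; apply/measurable_EFinP; exact: measurable_indic.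
- by move=> v x _; rewrite mule_ge0// lee_fin.
Qed.

(** * Existence of Gibbs measures with given boundary condition *)

Section existence.
Variables (R : realType) (d : nat) (beta lambda h : R).

Let kern := @wr_kernel R d beta lambda h.

(* The sites on which the energy in [L] depends: the range of the interaction is
   finite. *)
Let reach (L : {fset site d}) : {fset site d} :=
  (L `|` \bigcup_(e <- fset_set (bedges L)) e)%fset.

Let agree_exponent L x y : agree (reach L) x y ->
  wr_exponent beta lambda h L x = wr_exponent beta lambda h L y.
Proof.
move=> xy; rewrite /wr_exponent; congr (_ * _ + _).
  apply: eq_fsbigr => e /set_mem eL; congr (nat_of_bool (_ == _))%:R.
  apply: eq_big_seq => i ie; rewrite xy// inE; apply/orP; right.
  by apply/bigfcupP; exists e => //; rewrite andbT in_fset_set ?inE//; exact: finite_bedges.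
by apply: eq_big_seq => i iL; rewrite xy// inE iL.
Qed.

Let agree_paste (L M : {fset site d}) (w : {ffun L -> spin}) x y :
  agree M x y -> agree M (paste w x) (paste w y).
Proof.
move=> xy i iM; have [iL|iL] := boolP (i \in L); first by rewrite !(paste_in _ _ iL).
by rewrite !paste_notin// xy.
Qed.

Let agree_kernel (L : {fset site d}) (C : set (config d)) : cylinder C ->
  exists M : {fset site d}, forall x y, agree M x y ->
    kern L x (C : set (confT d)) = kern L y (C : set (confT d)).
Proof.
move=> [M CM]; exists (reach L `|` M)%fset => x y xy.
have xyL : agree (reach L) x y by move=> i iL; rewrite xy// inE iL.
have xyM : agree M x y by move=> i iM; rewrite xy// inE iM orbT.
rewrite /= /wr_measure; apply: eq_bigr => w _.
have we (v : {ffun L -> spin}) : wr_weight beta lambda h v x = wr_weight beta lambda h v y.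
  by rewrite /wr_weight (agree_exponent (agree_paste v xyL)).
rewrite /wr_prob /wr_Z we; under eq_bigr do rewrite we.
congr (_ * _)%E; rewrite !diracE; congr (nat_of_bool _)%:R%:E.
have := agree_paste w xyM => xywM.
apply/idP/idP => /set_mem Cw; apply/mem_set; first exact: CM Cw.
by apply: CM Cw; exact: agree_sym.
Qed.

(** As [kern L _ C] depends on finitely many coordinates, its integrals converge
    together with the probabilities of cylinder sets. For boxes containing [L] the
    consistency of the specification says that these integrals are the
    probabilities of [C], and the DLR equation passes to the limit. *)
Lemma gibbs_limit (eta : config d) (U : set_system nat) : UltraFilter U -> \oo `<=` U ->
  exists2 mu : probability (confT d) R, gibbs (wr_spec d beta lambda h) mu &
    forall A : set (confT d), cylinder A ->
      (fun n => fine (kern (box d n) eta A)) @ U --> fine (mu A).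
Proof.
move=> UU Uoo; have UF : ProperFilter U := ultra_proper.
have P1 n : kern (box d n) eta setT = 1%E by exact: prob_kernel.
have [mu muE] := cylinder_limit_measure (P := fun n => kern (box d n) eta) P1 UU Uoo.
exists mu => //; apply: dlr_cylinder_gibbs => L C cC.
have mC := cylinder_measurable cC.
have [M kM] := agree_kernel L cC.
pose phi x := fine (kern L x C).
have phiE x : kern L x C = (phi x)%:E.
  rewrite /phi fineK// ge0_fin_numE// (@le_lt_trans _ _ 1%E) ?ltry//.
  by rewrite -(@prob_kernel _ _ _ _ _ (kern L) x) le_measure// inE.
have phi0 x : 0 <= phi x by exact: fine_ge0.
have phiM x y : agree M x y -> phi x = phi y by move=> /kM; rewrite /phi => ->.
have intE (Q : {measure set (confT d) -> \bar R}) :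
    (\int[Q]_x kern L x C = \sum_(v : {ffun M -> spin})
      (phi (paste v eta))%:E * Q (restr M @^-1` [set v]))%E.
  by under eq_integral do rewrite phiE; exact: integral_cylinder.
pose S (Q : {measure set (confT d) -> \bar R}) : R := \sum_(v : {ffun M -> spin})
  phi (paste v eta) * fine (Q (restr M @^-1` [set v])).
have SE (Q : {measure set (confT d) -> \bar R}) : Q setT = 1%E ->
    (\int[Q]_x kern L x C = (S Q)%:E)%E.
  move=> Q1; rewrite intE -sumEFin; apply: eq_bigr => v _.
  have fQ : Q (restr M @^-1` [set v]) \is a fin_num.
    rewrite ge0_fin_numE// (@le_lt_trans _ _ 1%E) ?ltry//.
    by rewrite -Q1 le_measure// inE//; exact: measurable_fiber.
  by rewrite EFinM (fineK fQ).
have S1 : (fun n => S (kern (box d n) eta)) @ U --> S mu.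
  apply: cvg_big => [|v _]; first exact: add_continuous.
  by apply: cvgM; [exact: cvg_cst|exact/muE/cylinder_fiber].
have S2 : (fun n => S (kern (box d n) eta)) @ U --> fine (mu C).
  apply: cvg_trans (muE C cC); apply: near_eq_cvg.
  apply: Uoo; apply: filterS (sub_box_near L) => n Ln.
  by rewrite -[in LHS](wr_consistent beta lambda h Ln mC eta) SE.
rewrite SE; last exact: probability_setT.
by rewrite (cvg_unique _ S1 S2)// fineK// fin_num_measure.
Qed.

End existence.

(** * Spin-flip symmetry at zero field *)

Section symmetry.
Variables (R : realType) (d : nat) (beta lambda : R) (L : {fset site d}).

Definition flipc (x : config d) : config d := fun i => flip (x i).
Definition flipw (w : {ffun L -> spin}) : {ffun L -> spin} := [ffun i => flip (w i)].

Lemma flipwK : involutive flipw.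
Proof. by move=> w; apply/ffunP => i; rewrite !ffunE flipK. Qed.

Lemma paste_flip (w : {ffun L -> spin}) eta :
  paste (flipw w) (flipc eta) = flipc (paste w eta).
Proof.
apply/funext => i; rewrite /flipc; have [iL|iL] := boolP (i \in L).
  by rewrite !(paste_in _ _ iL) ffunE.
by rewrite !paste_notin.
Qed.

Lemma wr_exponent_flip x :
  wr_exponent beta lambda 0 L (flipc x) = wr_exponent beta lambda 0 L x.
Proof.
rewrite /wr_exponent; congr (_ * _ + _).
  apply: eq_fsbigr => e /set_mem [i [j [-> ij _]]].
  rewrite -![(_ == _)%:R]/(conflict R _ _) !conflictE//.
  by rewrite !spin_val_flip mulrNN.
by apply: eq_bigr => i _; rewrite !mul0r spin_val_flip rmorphN sqrrN.
Qed.

Lemma wr_prob_flip (w : {ffun L -> spin}) eta :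
  wr_prob beta lambda 0 (flipw w) (flipc eta) = wr_prob beta lambda 0 w eta.
Proof.
have we (v : {ffun L -> spin}) :
    wr_weight beta lambda 0 (flipw v) (flipc eta) = wr_weight beta lambda 0 v eta.
  by rewrite /wr_weight paste_flip wr_exponent_flip.
rewrite /wr_prob we; congr (_ / _); rewrite /wr_Z (reindex_inj (inv_inj flipwK)).
by apply: eq_bigr.
Qed.

End symmetry.

(** * Coexistence of the plus and minus phases *)

Section coexistence.
Variables (R : realType) (d : nat) (d2 : (2 <= d)%N) (beta lambda : R).
Hypotheses (Kb : ln (peierls_constant R d) <= beta) (Kl : peierls_constant R d <= lambda).

Lemma wr_kernel_coord (L : {fset site d}) (eta : config d) (Q : pred spin) :
  fine (wr_kernel beta lambda 0 L eta [set x : confT d | Q (x 0)]) =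
  \sum_(w : {ffun L -> spin} | Q (paste w eta 0)) wr_prob beta lambda 0 w eta.
Proof.
rewrite /= /wr_measure.
rewrite (eq_bigr (fun w => (wr_prob beta lambda 0 w eta * (Q (paste w eta 0))%:R)%:E)); last first.
  by move=> w _; rewrite diracE EFinM; congr (_ * _%:R%:E)%E; congr nat_of_bool;
     apply/idP/idP => [/set_mem//|Qw]; exact/mem_set.
rewrite sumEFin /= [RHS]big_mkcond /=; apply: eq_bigr => w _.
by case: ifP; rewrite ?mulr1 ?mulr0.
Qed.

Lemma plus_boundary_bound n :
  fine (wr_kernel beta lambda 0 (box d n) (fun=> plus) [set x : confT d | x 0 != plus]) <= 3^-1.
Proof. by rewrite (wr_kernel_coord _ _ (fun s => s != plus)); exact: peierls_bound. Qed.

(** The flip exchanges the two boundary conditions, and a flipped spin that is plus was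
    minus before, in particular not plus. *)
Lemma minus_boundary_bound n :
  fine (wr_kernel beta lambda 0 (box d n) (fun=> minus) [set x : confT d | x 0 == plus]) <= 3^-1.
Proof.
rewrite (wr_kernel_coord _ _ (fun s => s == plus)).
have -> : (fun=> minus) = flipc (fun=> plus : spin) :> config d by apply/funext.
rewrite (reindex_inj (inv_inj (@flipwK d (box d n)))) /=.
under eq_bigl do rewrite paste_flip.
under eq_bigr do rewrite wr_prob_flip.
apply: le_trans (peierls_bound d2 n Kb Kl).
rewrite [X in _ <= X]big_mkcond [X in X <= _]big_mkcond; apply: ler_sum => w _.
rewrite /flipc; case: (eqVneq (flip _) plus) => [fp|_]; last first.
  by case: ifP => // _; exact: wr_prob_ge0.
case: ifPn => //; rewrite negbK => /eqP p; have := fp; rewrite p => /(congr1 spin_val).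
by rewrite spin_val_flip.
Qed.

Lemma wr_phase_transition : phase_transition (wr_spec d beta lambda 0).
Proof.
have [U [UU Uoo]] := ultraFilterLemma (@eventually_filter).
have UF : ProperFilter U := ultra_proper.
have [mu gmu muE] := @gibbs_limit R d beta lambda 0 (fun=> plus) U UU Uoo.
have [nu gnu nuE] := @gibbs_limit R d beta lambda 0 (fun=> minus) U UU Uoo.
pose A : set (confT d) := [set x | x 0 == plus].
have cA : cylinder A by exact: (cylinder_coord 0 [set s | s == plus]).
have mA := cylinder_measurable cA.
have cE : ~` A = [set x : confT d | x 0 != plus].
  by apply/seteqP; split=> x /=; move/negP.
have muA : fine (mu (~` A)) <= 3^-1.
  apply: (cvgr_to_le (muE _ (cylinderC cA))); apply: filterE => n.
  by rewrite cE; exact: plus_boundary_bound.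
have nuA : fine (nu A) <= 3^-1.
  by apply: (cvgr_to_le (nuE _ cA)); apply: filterE => n; exact: minus_boundary_bound.
exists mu, nu; split=> //; exists A => // mn.
move: muA; rewrite probability_setC// mn.
move: nuA; rewrite -[nu A]fineK ?fin_num_measure//=; lra.
Qed.

End coexistence.

Theorem theorem2p2 (R : realType) (d : nat) (hd : (2 <= d)%N) :
  exists beta_c lambda_c : R,
    [/\ 0 < beta_c, 0 < lambda_c &
      forall beta lambda : R, beta_c <= beta -> lambda_c <= lambda ->
        phase_transition (wr_spec d beta lambda 0)].
Proof.
have K1 := peierls_constant_gt1 R d.
exists (ln (peierls_constant R d)), (peierls_constant R d); split.
- exact: ln_gt0.
- exact: lt_trans K1.
- by move=> beta lambda; exact: wr_phase_transition.
Qed.
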